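(* Let $M$ be a $6$-manifold with an $\mathrm{SU}(3)$-structure $(\omega,\Psi)$ preserved by a regular vector field $X$, with quotient data $(N,\alpha,\omega_1,\omega_2,\omega_3,\phi,t)$ as defined in the context. Then $M$ is symplectic half-flat if and only if the quotient satisfies \[d\alpha=0,\qquad d\omega_1=0,\qquad d\omega_2\wedge\alpha=t^2\,\omega_1\wedge\phi+2\,d\log t\wedge\omega_2\wedge\alpha,\] \[d\omega_3=d\log t\wedge\omega_3-t\,\alpha\wedge\phi.\]
   Context: SU(3)-structure: a pair $(\omega,\Psi)$ on a $6$-manifold, locally of the form $\omega=e^{14}+e^{25}+e^{36}$, $\Psi=(e^1+ie^4)\wedge(e^2+ie^5)\wedge(e^3+ie^6)$ for some coframe $e^1,\dots,e^6$ (where $e^{ij}=e^i\wedge e^j$), which is then orthonormal for the induced metric. Put $\psi^+=\mathrm{Re}\,\Psi$, $\psi^-=\mathrm{Im}\,\Psi$. The structure is symplectic half-flat if $d\omega=0$ and $d\psi^+=0$. SU(2)-structure on a $5$-manifold: forms $(\alpha,\omega_1,\omega_2,\omega_3)$ such that locally there is a coframe $e^1,\dots,e^5$ with $\alpha=e^5$, $\omega_1=e^{12}+e^{34}$, $\omega_2=e^{13}+e^{42}$, $\omega_3=e^{14}+e^{23}$. Quotient data: $X$ is a nowhere-zero vector field on $M$ with $\mathcal{L}_X\omega=0=\mathcal{L}_X\psi^+$ (hence Killing), whose integral curves are the fibres of a submersion $M\to N$ onto a $5$-manifold. No compactness is assumed. Let $t>0$ be the norm of $X$ (a function on $N$), $\eta$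 the one-form on $M$ which is a pointwise multiple of the metric dual of $X$ with $\eta(X)=1$, and $\phi=d\eta$. Set \[\alpha=X\lrcorner\,\omega,\quad \omega_1=X\lrcorner\,\psi^+,\quad \omega_2=X\lrcorner\,\psi^-,\quad \omega_3=t\,X\lrcorner(\omega\wedge\eta).\] These forms and $\phi$ are pullbacks of forms on $N$, denoted by the same symbols; $(\alpha,\omega_i)$ is an $\mathrm{SU}(2)$-structure on $N$, and $\omega=t^{-1}\omega_3+\eta\wedge\alpha$, $\Psi=(\omega_1+i\omega_2)\wedge(\eta+it^{-2}\alpha)$. *)

(* Defs.v *)
From HB Require Import structures.
From mathcomp Require Import all_boot all_order all_algebra all_fingroup.
From mathcomp Require Import all_classical all_reals all_analysis.
From mathcomp Require Import complex.

Set Implicit Arguments.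
Unset Strict Implicit.
Unset Printing Implicit Defensive.

Import Order.TTheory GRing.Theory Num.Theory.
Import numFieldNormedType.Exports.

Local Open Scope classical_set_scope.
Local Open Scope ring_scope.

(* C^oo on an open set U: every iterated directional derivative of f is
   Frechet differentiable at every point of U. *)
Definition smooth_on (R : realType) (V W : normedModType R)
    (U : set V) (f : V -> W) : Prop :=
  forall (vs : seq V) (x : V), U x ->
    differentiable (foldr (fun v g => 'D_v g) f vs) x.

(* A smooth n-manifold without boundary, presented by an atlas (not necessarily
   maximal).  [chart_inv c] is meaningful only on [chart c @` chart_dom c]. *)
Record manifold (R : realType) (n : nat) := Manifold {
  points :> topologicalType ;
  points_hausdorff : hausdorff_space points ;
  points_second_countable : @second_countable points ;
  atlas : Type ;
  chart_dom : atlas -> set points ;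
  chart : atlas -> points -> 'rV[R]_n ;
  chart_inv : atlas -> 'rV[R]_n -> points ;
  chart_dom_open : forall c, open (chart_dom c) ;
  chart_dom_cover : forall p, exists c, chart_dom c p ;
  chart_cod_open : forall c, open (chart c @` chart_dom c) ;
  chart_continuous : forall c p, chart_dom c p -> {for p, continuous (chart c)} ;
  chart_inv_continuous : forall c p, chart_dom c p ->
    {for chart c p, continuous (chart_inv c)} ;
  chartK : forall c p, chart_dom c p -> chart_inv c (chart c p) = p ;
  transition_smooth : forall c c',
    smooth_on (chart c @` (chart_dom c `&` chart_dom c')) (chart c' \o chart_inv c)
}.
Arguments atlas {R n} m.
Arguments chart_dom {R n m} c.
Arguments chart {R n m} c.
Arguments chart_inv {R n m} c.

Definition chart_cod (R : realType) (n : nat) (M : manifold R n) (c : atlas M)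
  : set 'rV[R]_n := chart c @` chart_dom c.

Section Maps.
Variables (R : realType) (m n : nat) (M : manifold R m) (N : manifold R n).

Definition local_map (f : M -> N) (c : atlas M) (c' : atlas N)
  : 'rV[R]_m -> 'rV[R]_n := chart c' \o f \o chart_inv c.

Definition smooth_map (f : M -> N) : Prop :=
  continuous f /\
  forall c c', smooth_on (chart c @` (chart_dom c `&` f @^-1` chart_dom c'))
                         (local_map f c c').

(* Jacobians act on row vectors from the right, so that the differential is
   onto exactly when the Jacobian is [row_full]. *)
Definition submersion (f : M -> N) : Prop :=
  smooth_map f /\
  forall c c' p, chart_dom c p -> chart_dom c' (f p) ->
    row_full ('J (local_map f c c') (chart c p)).

End Maps.

(* A k-form with values in K; the k arguments are the rows of a matrix. *)
Definition eform (R : realType) (K : Type) (n k : nat) : Type :=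
  'rV[R]_n -> 'M[R]_(k, n) -> K.

Section EuclideanForms.
Variables (R : realType) (n : nat).

Definition multilinear_form k (f : 'M[R]_(k, n) -> R) : Prop :=
  forall (A B C : 'M[R]_(k, n)) (i : 'I_k) (b c : R),
    row i A = b *: row i B + c *: row i C ->
    row' i B = row' i A -> row' i C = row' i A ->
    f A = b * f B + c * f C.

Definition alternating_form k (f : 'M[R]_(k, n) -> R) : Prop :=
  forall (A : 'M[R]_(k, n)) (i j : 'I_k),
    i != j -> row i A = row j A -> f A = 0.

Definition is_eform k (U : set 'rV[R]_n) (w : eform R R n k) : Prop :=
  (forall x, U x -> multilinear_form (w x) /\ alternating_form (w x)) /\
  (forall A, smooth_on U (fun x => w x A)).

(* Determinant convention: (e^1 ^ e^2)(u, v) = e^1(u) e^2(v) - e^1(v) e^2(u). *)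
Definition ewedge (K : fieldType) k l (a : eform R K n k) (b : eform R K n l)
  : eform R K n (k + l) :=
  fun x A => (k`! * l`!)%:R^-1 *
    \sum_(s : 'S_(k + l)) (-1) ^+ s *
      (a x (usubmx (row_perm s A)) * b x (dsubmx (row_perm s A))).

Definition ediff k (w : eform R R n k) : eform R R n k.+1 :=
  fun x A => \sum_(i < k.+1)
    (-1) ^+ i * 'D_(row i A) (fun y => w y (row' i A)) x.

Definition ecomplex k (a b : eform R R n k) : eform R R[i] n k :=
  fun x A => Complex (a x A) (b x A).

End EuclideanForms.

(* A form, resp. a vector field, is given by its representatives in all the
   charts of the atlas; only the values on [chart_cod c] are meaningful, and the
   representatives of genuine objects agree on overlaps. *)
Definition mform (R : realType) (n : nat) (M : manifold R n) (K : Type)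
  (k : nat) : Type := atlas M -> eform R K n k.

Definition mfield (R : realType) (n : nat) (M : manifold R n) : Type :=
  atlas M -> 'rV[R]_n -> 'rV[R]_n.

Definition mtensor2 (R : realType) (n : nat) (M : manifold R n) : Type :=
  atlas M -> 'rV[R]_n -> 'rV[R]_n -> 'rV[R]_n -> R.

(* w' = f^* w, i.e. w'_p(v_1, ...) = w_{f p}(df v_1, ...) *)
Definition is_pullback (R : realType) (m n k : nat)
    (M : manifold R m) (N : manifold R n) (f : M -> N)
    (w : mform N R k) (w' : mform M R k) : Prop :=
  forall c c' p, chart_dom c p -> chart_dom c' (f p) -> forall A,
    w' c (chart c p) A =
    w c' (chart c' (f p)) (A *m 'J (local_map f c c') (chart c p)).

Section TensorFields.
Variables (R : realType) (n : nat) (M : manifold R n).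

Definition is_mform k (w : mform M R k) : Prop :=
  (forall c, is_eform (chart_cod c) (w c)) /\ is_pullback id w w.

Definition is_mfield (X : mfield M) : Prop :=
  (forall c, smooth_on (chart_cod c) (X c)) /\
  (forall c c' p, chart_dom c p -> chart_dom c' p ->
     X c' (chart c' p) =
     X c (chart c p) *m 'J (chart c' \o chart_inv c) (chart c p)).

Definition form_eq K k (v w : mform M K k) : Prop :=
  forall c x, chart_cod c x -> forall A, v c x A = w c x A.

Definition form_zero k : mform M R k := fun _ _ _ => 0.

Definition form_add k (v w : mform M R k) : mform M R k :=
  fun c x A => v c x A + w c x A.

Definition form_sub k (v w : mform M R k) : mform M R k :=
  fun c x A => v c x A - w c x A.

Definition form_scale k (f : M -> R) (w : mform M R k) : mform M R k :=
  fun c x A => f (chart_inv c x) * w c x A.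

Definition form_of_fun (f : M -> R) : mform M R 0 := fun c x _ => f (chart_inv c x).

Definition form_wedge (K : fieldType) k l (v : mform M K k) (w : mform M K l)
  : mform M K (k + l) := fun c => ewedge (v c) (w c).

Definition form_diff k (w : mform M R k) : mform M R k.+1 := fun c => ediff (w c).

Definition int_product k (X : mfield M) (w : mform M R k.+1) : mform M R k :=
  fun c x A => w c x (col_mx (X c x) A : 'M[R]_(1 + k, n)).

(* (L_X w)(v_1, ..., v_k)
     = D_X (w(v_1, ..., v_k)) + sum_i w(v_1, ..., D_{v_i} X, ..., v_k)
   for constant v_1, ..., v_k in a chart *)
Definition lie_derivative k (X : mfield M) (w : mform M R k) : mform M R k :=
  fun c x A =>
    'D_(X c x) (fun y => w c y A) x +
    \sum_(i < k) w c x (\matrix_(j < k)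
       if j == i then row i A *m 'J (X c) x else row j A).

Definition re_form k (w : mform M R[i] k) : mform M R k :=
  fun c x A => complex.Re (w c x A).
Definition im_form k (w : mform M R[i] k) : mform M R k :=
  fun c x A => complex.Im (w c x A).

End TensorFields.

Arguments form_zero {R n M k}.

Declare Scope mform_scope.
Delimit Scope mform_scope with F.
Bind Scope mform_scope with mform.
Notation "v == w" := (form_eq v w) : mform_scope.
Notation "0" := form_zero : mform_scope.
Notation "v + w" := (form_add v w) : mform_scope.
Notation "v - w" := (form_sub v w) : mform_scope.
Notation "f *: w" := (form_scale f w) : mform_scope.
Notation "v /\~ w" := (form_wedge v w) (at level 38, left associativity)
  : mform_scope.
Notation "X _| w" := (int_product X w) (at level 36, right associativity)
  : mform_scope.

Section SU3.
Variables (R : realType) (M : manifold R 6).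

(* e 1, ..., e 6 are the members of the coframe; other indices are not used. *)
Definition is_coframe (V : set 'rV[R]_6) (e : nat -> eform R R 6 1) : Prop :=
  (forall i, (0 < i < 7)%N -> is_eform V (e i)) /\
  (forall x, V x -> forall a : nat -> R,
     (forall v, \sum_(1 <= i < 7) a i * e i x v = 0) ->
     forall i, (0 < i < 7)%N -> a i = 0).

Definition adapted_coframe (omega : eform R R 6 2) (Psi : eform R R[i] 6 3)
    (V : set 'rV[R]_6) (e : nat -> eform R R 6 1) : Prop :=
  [/\ is_coframe V e,
    forall x, V x -> forall A,
      omega x A = ewedge (e 1%N) (e 4%N) x A + ewedge (e 2%N) (e 5%N) x A
                  + ewedge (e 3%N) (e 6%N) x A
  & forall x, V x -> forall A,
      Psi x A = ewedge (ewedge (ecomplex (e 1%N) (e 4%N))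
                               (ecomplex (e 2%N) (e 5%N)))
                       (ecomplex (e 3%N) (e 6%N)) x A].

Definition su3_structure (omega : mform M R 2) (Psi : mform M R[i] 3) : Prop :=
  [/\ is_mform omega, is_mform (re_form Psi), is_mform (im_form Psi)
  & forall c x, chart_cod c x -> exists V e,
      [/\ open V, V x, V `<=` chart_cod c & adapted_coframe (omega c) (Psi c) V e]].

(* g = sum_i e^i (x) e^i locally; as SU(3) is contained in SO(6), this does not
   depend on the adapted coframe. *)
Definition induced_metric (omega : mform M R 2) (Psi : mform M R[i] 3)
    (g : mtensor2 M) : Prop :=
  forall c x, chart_cod c x -> exists V e,
    [/\ open V, V x, V `<=` chart_cod c, adapted_coframe (omega c) (Psi c) V e
    & forall y, V y -> forall u v,
        g c y u v = \sum_(1 <= i < 7) e i y u * e i y v].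

Definition symplectic_half_flat (omega : mform M R 2) (Psi : mform M R[i] 3)
  : Prop :=
  (form_diff omega == 0)%F /\ (form_diff (re_form Psi) == 0)%F.

End SU3.

Section Quotient.
Variables (R : realType) (M : manifold R 6) (N : manifold R 5).

Definition integral_curve (X : mfield M) (I : set R) (gamma : R -> M) : Prop :=
  forall s, I s ->
    {for s, continuous gamma} /\
    forall c, chart_dom c (gamma s) ->
      is_derive s 1 (chart c \o gamma) (X c (chart c (gamma s))).

Definition same_orbit (X : mfield M) (p q : M) : Prop :=
  exists (I : set R) (gamma : R -> M),
    [/\ open I, is_interval I, integral_curve X I gamma
    & exists a b, [/\ I a, I b, gamma a = p & gamma b = q]].

Definition regular_vector_field (X : mfield M) (pi : M -> N) : Prop :=
  [/\ is_mfield X, forall c x, chart_cod c x -> X c x <> 0,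
      submersion pi, forall y, exists p, pi p = y
    & forall p q, pi p = pi q <-> same_orbit X p q].

Definition preserves (X : mfield M) (omega : mform M R 2)
    (Psi : mform M R[i] 3) : Prop :=
  (lie_derivative X omega == 0)%F /\ (lie_derivative X (re_form Psi) == 0)%F.

(* Forms on N are determined by their pullbacks, pi being a surjective
   submersion.  Since X has no zero, the norm t is automatically positive. *)
Record quotient_data (omega : mform M R 2) (Psi : mform M R[i] 3)
    (X : mfield M) (pi : M -> N) (g : mtensor2 M) (eta : mform M R 1)
    (alpha : mform N R 1) (omega1 omega2 omega3 phi : mform N R 2)
    (t : N -> R) : Prop := QuotientData {
  qd_metric : induced_metric omega Psi g ;
  qd_t : is_mform (form_of_fun t) ;
  qd_norm : forall c p, chart_dom c p ->
    t (pi p) = Num.sqrt (g c (chart c p) (X c (chart c p)) (X c (chart c p))) ;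
  qd_eta : is_mform eta ;
  qd_eta_dual : forall c x, chart_cod c x ->
    exists lambda : R, forall v, eta c x v = lambda * g c x (X c x) v ;
  qd_eta_X : forall c x, chart_cod c x -> eta c x (X c x) = 1 ;
  qd_alpha : is_mform alpha /\ is_pullback pi alpha (X _| omega)%F ;
  qd_omega1 : is_mform omega1 /\ is_pullback pi omega1 (X _| re_form Psi)%F ;
  qd_omega2 : is_mform omega2 /\ is_pullback pi omega2 (X _| im_form Psi)%F ;
  qd_omega3 : is_mform omega3 /\
    is_pullback pi omega3 ((t \o pi) *: (X _| (omega /\~ eta)))%F ;
  qd_phi : is_mform phi /\ is_pullback pi phi (form_diff eta)
}.

End Quotient.

(* Main.v *)
Require Import Defs.
From mathcomp Require Import all_boot all_order all_algebra all_fingroup.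
From mathcomp Require Import all_classical all_reals all_analysis.
From mathcomp Require Import complex.
From mathcomp Require Import ring.

(* Since [pi p = pi p], there is an integral curve of [X] through every point and
   [pi] is constant on it, so [X] is killed by [d pi].  At each point
     omega = t^-1 omega3 - alpha /\ eta,
     psi+  = omega1 /\ eta - t^-2 omega2 /\ alpha,
   the second identity being the real part of
     |X|^2 Psi = (X _| Psi) /\ (X^flat + i X _| omega),
   which holds because [X^flat + i X _| omega] lies in the span of the three
   complex factors of [Psi].  Differentiating, and using that pullback commutes
   with [d] (by the symmetry of second derivatives), d omega and d psi+ take the
   form [pi^* h + pi^* a /\ eta].  Such a form vanishes iff [a] and [h] do:
   contract with [X] and use that [d pi] is onto. *)

Set Implicit Arguments.
Unset Strict Implicit.
Unset Printing Implicit Defensive.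

Import Order.TTheory GRing.Theory Num.Theory.
Import numFieldNormedType.Exports.

Local Open Scope classical_set_scope.
Local Open Scope ring_scope.

(** * Alternation *)

(** Wedge products and [d] are both rewritten as unnormalised sums over permutations
    ([alternation]). The Leibniz rule and the expansions along a 1-form then come down to the sign
    of the cycle that moves one row to the front; shuffles never appear, and the factorials cancel
    at the end.

    With d eta = phi the two derivatives are d omega = [d(t^-1 omega3) + alpha /\ phi] - d alpha /\
    eta, d psi+ = [omega1 /\ phi - d(t^-2 omega2) /\ alpha - t^-2 omega2 /\ d alpha] + d omega1 /\
    eta. Since d(t^-k w) = t^-k (dw - k d log t /\ w), the exponents 1 and 2 become the coefficients
    of d log t in the equations for omega3 and omega2. The exponent 2 itself comes from eta(X) = 1,
    which forces X^flat = t^2 eta. The term with d alpha couples the two equations: d psi+ is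
    analysed only after d alpha = 0 has been extracted from d omega.

    Everything is proved at a single point, in one chart above and one below, because forms are
    given by their chart representatives. *)

Section Alternation.
Variables (R : Type) (K : fieldType) (n : nat).

Definition alternation k (F : 'M[R]_(k, n) -> K) (A : 'M[R]_(k, n)) : K :=
  \sum_(s : 'S_k) (-1) ^+ s * F (row_perm s A).

(** Stated through permutations, and with values in any field, because this is the property that
    [alternation] produces and consumes, also for complex forms. *)
Definition skew_form k (F : 'M[R]_(k, n) -> K) : Prop :=
  forall (s : 'S_k) A, F (row_perm s A) = (-1) ^+ s * F A.

Lemma eq_alternation k (F G : 'M[R]_(k, n) -> K) :
  F =1 G -> alternation F =1 alternation G.
Proof. by move=> FG A; apply: eq_bigr => s _; rewrite FG. Qed.

Lemma alternation_comp_row_perm k (F : 'M[R]_(k, n) -> K) (s : 'S_k) A :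
  alternation (fun B => F (row_perm s B)) A = (-1) ^+ s * alternation F A.
Proof.
rewrite /alternation mulr_sumr (reindex_inj (mulgI s^-1%g)) /=.
apply: eq_bigr => u _.
by rewrite -row_permM mulgA mulgV mul1g odd_permM odd_permV signr_addb mulrA.
Qed.

Lemma alternation_skew k (F : 'M[R]_(k, n) -> K) : skew_form (alternation F).
Proof.
move=> s A; rewrite /alternation mulr_sumr (reindex_inj (mulIg s^-1%g)) /=.
apply: eq_bigr => u _.
by rewrite -row_permM -mulgA mulVg mulg1 odd_permM odd_permV signr_addb mulrA
  [(-1) ^+ s * _]mulrC.
Qed.

Lemma alternation_of_skew k (F : 'M[R]_(k, n) -> K) A :
  skew_form F -> alternation F A = k`!%:R * F A.
Proof.
move=> skF; rewrite /alternation -card_Sn.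
under eq_bigr => s _ do rewrite skF mulrA -signr_addb addbb mul1r.
by rewrite sumr_const mulr_natl.
Qed.

Lemma row_perm_lift_perm k (i : 'I_k.+1) (s : 'S_k) (A : 'M[R]_(k.+1, n)) :
  row_perm (lift_perm ord0 i s) A =
  col_mx (row i A) (row_perm s (row' i A)) :> 'M[R]_(1 + k, n).
Proof.
apply/matrixP => a b; rewrite !mxE; case: splitP => [j|j] aj; rewrite !mxE.
  have -> : a = ord0 by apply: val_inj; rewrite /= aj; case: j {aj} => -[].
  by rewrite lift_perm_id.
have -> : a = lift ord0 j by apply: val_inj.
by rewrite lift_perm_lift.
Qed.

(** Laplace expansion along the first argument: the permutations sending [ord0] to [i] are the
    [lift_perm ord0 i s], whose sign is that of [s] times (-1)^i. *)
Lemma alternation_recl k (F : 'M[R]_(k.+1, n) -> K) A :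
  alternation F A =
  \sum_(i < k.+1) (-1) ^+ i *
    alternation (fun B => F (col_mx (row i A) B : 'M[R]_(1 + k, n))) (row' i A).
Proof.
rewrite /alternation (partition_big (fun s : 'S_k.+1 => s ord0) predT) //=.
apply: eq_bigr => i _; rewrite mulr_sumr.
have bij : {on [pred s : 'S_k.+1 | s ord0 == i], bijective (lift_perm ord0 i)}.
  (* [ul s] is [s] with [ord0] and its image deleted. The default value is never taken, since [s] is
     injective. *)
  pose ul (s : 'S_k.+1) m := odflt m (unlift (s ord0) (s (lift ord0 m))).
  have ulK (s : 'S_k.+1) m : lift (s ord0) (ul s m) = s (lift ord0 m).
    rewrite /ul; have := neq_lift ord0 m.
    by rewrite -(can_eq (permK s)) => /unlift_some[m' em ->].
  have ul_inj s : injective (ul s).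
    move=> m m' /(congr1 (lift (s ord0))); rewrite !ulK.
    by move/perm_inj/lift_inj.
  exists (fun s => perm (ul_inj s)) => [s _ | s /eqP s0].
    by apply/permP=> m; rewrite permE /ul lift_perm_lift lift_perm_id liftK.
  apply/permP=> m; case: (unliftP ord0 m) => [j|] ->; rewrite ?lift_perm_id //.
  by rewrite lift_perm_lift -s0 permE ulK.
rewrite (reindex _ bij) /=; apply: eq_big => [s|s _].
  by rewrite lift_perm_id eqxx.
by rewrite row_perm_lift_perm odd_lift_perm /= signr_addb signr_odd mulrA.
Qed.

(** Moving row [i] to the front is the cycle [lift_perm ord0 i 1], of sign (-1)^i. *)
Lemma alternation_cycle k (F : 'M[R]_(1 + k, n) -> K) (i : 'I_(1 + k)) A :
  alternation (fun B => F (col_mx (row i B) (row' i B))) A =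
  (-1) ^+ i * alternation F A.
Proof.
rewrite -signr_odd -[odd i]addbF -(odd_perm1 'I_k).
rewrite -[odd i](addFb) -(odd_lift_perm (ord0 : 'I_k.+1)).
rewrite -alternation_comp_row_perm; apply: eq_alternation => B.
by rewrite row_perm_lift_perm row_perm1.
Qed.

Lemma alternation_sum k m (F : 'I_m -> 'M[R]_(k, n) -> K) A :
  alternation (fun B => \sum_i F i B) A = \sum_i alternation (F i) A.
Proof.
rewrite /alternation exchange_big /=; apply: eq_bigr => s _.
by rewrite mulr_sumr.
Qed.

Lemma alternationZ k (c : K) (F : 'M[R]_(k, n) -> K) A :
  alternation (fun B => c * F B) A = c * alternation F A.
Proof. by rewrite /alternation mulr_sumr; apply: eq_bigr => s _; rewrite mulrCA. Qed.

Lemma alternationD k (F G : 'M[R]_(k, n) -> K) A :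
  alternation (fun B => F B + G B) A = alternation F A + alternation G A.
Proof. by rewrite /alternation -big_split; apply: eq_bigr => s _; rewrite mulrDr. Qed.

(** The transposition is odd, so the sum equals its own negative. This is what kills the second
    derivatives in [ediff_epull]. *)
Lemma alternation_xrow_inv k (F : 'M[R]_(k, n) -> K) (i j : 'I_k) A :
  (2 : K) != 0 -> i != j -> (forall B, F (xrow i j B) = F B) -> alternation F A = 0.
Proof.
move=> K2 ij FE; have := alternation_comp_row_perm F (tperm i j) A.
rewrite (eq_alternation FE) odd_tperm ij /= expr1 mulN1r => /eqP.
by rewrite -addr_eq0 -mulr2n -mulr_natl mulf_eq0 (negPf K2) => /eqP.
Qed.

Lemma alternation_cast k k' (e : k = k') (F : 'M[R]_(k', n) -> K) A :
  alternation F (castmx (e, erefl n) A) =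
  alternation (fun B => F (castmx (e, erefl n) B)) A.
Proof.
by subst k'; rewrite castmx_id; apply: eq_alternation => B; rewrite castmx_id.
Qed.

End Alternation.

(** * Alternating forms and wedge products *)

Lemma row_row' (R : Type) (k n : nat) (i : 'I_k.+1) (j : 'I_k) (A : 'M[R]_(k.+1, n)) :
  row j (row' i A) = row (lift i j) A.
Proof. by apply/rowP => b; rewrite !mxE. Qed.

Lemma row'_of_rows (R : Type) (k n : nat) (i : 'I_k) (A B : 'M[R]_(k, n)) :
  (forall m, m != i -> row m A = row m B) -> row' i A = row' i B.
Proof.
move=> AB; apply/matrixP => a b; rewrite !mxE.
have /AB /rowP /(_ b) : lift i a != i by rewrite eq_sym neq_lift.
by rewrite !mxE.
Qed.

Lemma rows_of_row' (R : Type) (k n : nat) (i j : 'I_k) (A B : 'M[R]_(k, n)) :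
  row' i A = row' i B -> j != i -> row j A = row j B.
Proof.
move=> AB; case: (unliftP i j) => [l ->|->]; rewrite ?eqxx // => _.
apply/rowP => b; rewrite !mxE.
by have := congr1 (fun M : 'M[R]_(k.-1, n) => M l b) AB; rewrite !mxE.
Qed.

Section ConsRow.
Variables (R : Type) (n k : nat) (v : 'rV[R]_n).

Lemma row0_col_mx (A : 'M[R]_(k, n)) : row (ord0 : 'I_(1 + k)) (col_mx v A) = v.
Proof.
by apply/rowP => j; rewrite !mxE; case: splitP => // m _; rewrite [m]ord1.
Qed.

Lemma row_lift0_col_mx (A : 'M[R]_(k, n)) (i : 'I_k) :
  row (lift ord0 i : 'I_(1 + k)) (col_mx v A) = row i A.
Proof.
apply/rowP => j; rewrite !mxE; case: splitP => m /= im.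
  by have := ltn_ord m; rewrite -im.
by congr (A _ _); apply: val_inj; case: im.
Qed.

Lemma row'0_col_mx (A : 'M[R]_(k, n)) : row' (ord0 : 'I_(1 + k)) (col_mx v A) = A.
Proof. by apply/row_matrixP => i; rewrite row_row' row_lift0_col_mx. Qed.

Lemma eq_col_mx_row (A : 'M[R]_(1 + k, n)) :
  row ord0 A = v -> A = col_mx v (row' ord0 A).
Proof.
move=> A0; apply/row_matrixP => i; case: (unliftP ord0 i) => [j|] ->.
  by rewrite row_lift0_col_mx row_row'.
by rewrite A0 row0_col_mx.
Qed.
End ConsRow.

Lemma row'_lift0_col_mx (R : Type) (n k : nat) (v : 'rV[R]_n)
    (A : 'M[R]_(k.+1, n)) (i : 'I_k.+1) :
  row' (lift ord0 i : 'I_(1 + k.+1)) (col_mx v A) =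
  col_mx v (row' i A) :> 'M[R]_(1 + k, n).
Proof.
apply/row_matrixP => a; rewrite row_row'.
case: (unliftP ord0 a) => [j|] ->; last first.
  rewrite row0_col_mx -[RHS](row0_col_mx v A); congr (row _ _).
  exact: val_inj.
rewrite row_lift0_col_mx row_row' -[RHS](row_lift0_col_mx v); congr (row _ _).
by apply: val_inj; rewrite /= /bump !add1n /= ltnS addnS.
Qed.

Section RowSet.
Variables (R : Type) (k n : nat).

Definition row_set (i : 'I_k) (r : 'rV[R]_n) (A : 'M[R]_(k, n)) : 'M[R]_(k, n) :=
  \matrix_(j < k) if j == i then r else row j A.

Lemma row_row_set i r A : row i (row_set i r A) = r.
Proof. by rewrite rowK eqxx. Qed.

Lemma row_setE i r A j : row_set i r A i j = r ord0 j.
Proof. by have /rowP /(_ j) := row_row_set i r A; rewrite mxE. Qed.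

Lemma row_row_set_neq i j r A : j != i -> row j (row_set i r A) = row j A.
Proof. by move=> /negPf ji; rewrite rowK ji. Qed.

Lemma row_set_neqE i m r A j : m != i -> row_set i r A m j = A m j.
Proof. by move=> mi; have /rowP /(_ j) := row_row_set_neq r A mi; rewrite !mxE. Qed.

Lemma row'_row_set i r A : row' i (row_set i r A) = row' i A.
Proof. by apply: row'_of_rows => m; exact: row_row_set_neq. Qed.

Lemma row_set_id i A : row_set i (row i A) A = A.
Proof. by apply/row_matrixP => m; rewrite rowK; case: eqP => [->|]. Qed.
End RowSet.

Section MultilinearForms.
Variables (R : realType) (n k : nat) (f : 'M[R]_(k, n) -> R).
Hypothesis mf : multilinear_form f.

Lemma multilinear_row_set (A : 'M[R]_(k, n)) i b c (r s : 'rV_n) :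
  f (row_set i (b *: r + c *: s) A) =
  b * f (row_set i r A) + c * f (row_set i s A).
Proof. by apply: (mf (i := i)); rewrite ?row_row_set ?row'_row_set. Qed.

Lemma multilinear_row0 (A : 'M[R]_(k, n)) i : row i A = 0 -> f A = 0.
Proof.
move=> Ai; rewrite -(row_set_id i A) Ai.
by rewrite -[0](addr0) -[X in X + _](scale0r (0 : 'rV[R]_n)) -[X in _ + X](scale0r (0 : 'rV[R]_n))
  multilinear_row_set !mul0r addr0.
Qed.

Lemma multilinear_row_set_sum m (A : 'M[R]_(k, n)) i (c : 'I_m -> R)
    (r : 'I_m -> 'rV[R]_n) :
  f (row_set i (\sum_j c j *: r j) A) = \sum_j c j * f (row_set i (r j) A).
Proof.
elim: m c r => [|m IH] c r.
  by rewrite !big_ord0 (@multilinear_row0 _ i) ?row_row_set.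
rewrite !big_ord_recl -[X in row_set _ (_ + X)]scale1r multilinear_row_set mul1r.
by rewrite IH.
Qed.

(** Polarisation: expanding the zero value on two equal rows r + s gives the sign of a
    transposition, and transpositions generate the symmetric group. *)
Lemma skew_of_alternating : alternating_form f -> skew_form f.
Proof.
move=> af.
have fx i j A : i != j -> f (xrow i j A) = - f A.
  move=> ij; pose r := row i A; pose s := row j A.
  pose S u v := row_set i u (row_set j v A).
  have Sl u v w : f (S (u + v) w) = f (S u w) + f (S v w).
    by rewrite /S -[u in LHS]scale1r -[v in LHS]scale1r multilinear_row_set !mul1r.
  have SC u v : S u v = row_set j v (row_set i u A).
    apply/row_matrixP => m; rewrite !rowK.
    by case: eqP => // ->; rewrite (negPf ij).
  have Sr u v w : f (S w (u + v)) = f (S w u) + f (S w v).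
    by rewrite !SC -[u in LHS]scale1r -[v in LHS]scale1r multilinear_row_set !mul1r.
  have S0 u : f (S u u) = 0.
    by apply: (af _ i j) => //; rewrite /S row_row_set row_row_set_neq 1?eq_sym ?row_row_set.
  have SA : S r s = A by rewrite /S row_set_id row_set_id.
  have SX : S s r = xrow i j A.
    apply/row_matrixP => m; apply/rowP => b; rewrite !mxE.
    case: (eqVneq m i) => [->|mi]; first by rewrite tpermL mxE.
    rewrite !mxE; case: (eqVneq m j) => [->|mj]; first by rewrite tpermR mxE.
    by rewrite tpermD 1?eq_sym ?mxE.
  have := S0 (r + s); rewrite Sl !Sr !S0 add0r addr0 SA SX => /eqP.
  by rewrite addrC addr_eq0 => /eqP.
move=> s; case: (prod_tpermP s) => ts -> {s}.
elim: ts => [|[i j] ts IH] /=; first by rewrite big_nil => _ A; rewrite row_perm1 odd_perm1 mul1r.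
case/andP => /= ij /IH{}IH A; rewrite big_cons row_permM odd_permM odd_tperm ij.
by rewrite signr_addb expr1 mulN1r mulNr -IH fx.
Qed.
End MultilinearForms.

Section Wedge.
Variables (R : realType) (K : numFieldType) (n : nat).
Implicit Types k l : nat.

Lemma ewedgeE k l (a : eform R K n k) (b : eform R K n l) x A :
  ewedge a b x A = (k`! * l`!)%:R^-1 *
    alternation (fun B => a x (usubmx B) * b x (dsubmx B)) A.
Proof. by []. Qed.

Lemma ewedge_skew k l (a : eform R K n k) (b : eform R K n l) x :
  skew_form (ewedge a b x).
Proof. by move=> s A; rewrite !ewedgeE alternation_skew mulrCA. Qed.

Lemma eq_ewedge k l (a a' : eform R K n k) (b b' : eform R K n l) x x' :
  a x =1 a' x' -> b x =1 b' x' -> ewedge a b x =1 ewedge a' b' x'.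
Proof.
move=> aa bb A; rewrite !ewedgeE; congr (_ * _); apply: eq_alternation => B.
by rewrite aa bb.
Qed.

(** Each term of [alternation_recl] alternates the form [a x], which is already skew; the resulting
    k! cancels the normalisation. *)
Lemma ewedge1l k (b : eform R K n 1) (a : eform R K n k) x (A : 'M[R]_(1 + k, n)) :
  skew_form (a x) ->
  ewedge b a x A = \sum_(i < 1 + k) (-1) ^+ i * (b x (row i A) * a x (row' i A)).
Proof.
move=> ska; rewrite ewedgeE alternation_recl mulr_sumr; apply: eq_bigr => i _.
rewrite mulrCA; congr (_ * _).
rewrite (eq_alternation (G := fun B => b x (row i A) * a x B)); last first.
  by move=> B; rewrite col_mxKu col_mxKd.
rewrite alternationZ alternation_of_skew // mulrCA; congr (_ * _).
by rewrite [(1`! * _)%N]mul1n mulrA mulVf ?mul1r // pnatr_eq0 -lt0n fact_gt0.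
Qed.

(* The cast only identifies [k + 1] with [k.+1]; it is the identity for numerals. *)
Lemma ewedge1r k (a : eform R K n k) (b : eform R K n 1) x (A : 'M[R]_(k.+1, n)) :
  skew_form (a x) ->
  ewedge a b x (castmx (esym (addn1 k), erefl n) A) =
  \sum_(i < k.+1) (-1) ^+ (k + i) * (a x (row' i A) * b x (row i A)).
Proof.
move=> ska; rewrite ewedgeE alternation_cast.
(* [G] takes the argument of the 1-form first, whereas in the wedge it comes last; the cycle at
   [ord_max] restores the order at the cost of (-1)^k. *)
pose G (C : 'M[R]_(1 + k, n)) := a x (dsubmx C) * b x (usubmx C).
rewrite (eq_alternation (G := fun B : 'M[R]_(1 + k, n) =>
   G (col_mx (row (@ord_max k) B) (row' (@ord_max k) B)))); last first.
  move=> B; rewrite /G col_mxKu col_mxKd; congr (a x _ * b x _).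
    apply/matrixP => i j; rewrite !mxE castmxE /=; congr (B _ _); last exact: val_inj.
    by apply: val_inj; rewrite /= /bump leqNgt ltn_ord.
  apply/matrixP => i j; rewrite !mxE castmxE /=; congr (B _ _); last exact: val_inj.
  by apply: val_inj => /=; rewrite ord1 addn0.
rewrite (alternation_cycle G (@ord_max k)) /=.
transitivity ((k`! * 1`!)%:R^-1 * ((-1) ^+ k * alternation
    (fun C : 'M[R]_(1 + k, n) => b x (usubmx C) * a x (dsubmx C)) A)).
  by do 2![congr (_ * _)]; apply: eq_alternation => C; rewrite /G mulrC.
rewrite mulrCA mulnC -ewedgeE ewedge1l // mulr_sumr; apply: eq_bigr => i _.
by rewrite mulrA -exprD [b _ _ * _]mulrC.
Qed.

(** Only the term in which [b] receives [v] survives. Meant for [a] pulled back from the base and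
    [v] vertical. *)
Lemma ewedge_contract k (a : eform R K n k.+1) (b : eform R K n 1) x v
    (A : 'M[R]_(k.+1, n)) :
  skew_form (a x) -> (forall B, row ord0 B = v -> a x B = 0) ->
  ewedge a b x (castmx (esym (addn1 k.+1), erefl n) (col_mx v A : 'M[R]_(1 + k.+1, n))) =
  (-1) ^+ k.+1 * (a x A * b x v).
Proof.
move=> ska a0; rewrite ewedge1r // big_ord_recl big1 ?addr0 => [|i _].
  by rewrite addn0 row'0_col_mx row0_col_mx.
by rewrite a0 ?mul0r ?mulr0 // row'_lift0_col_mx row0_col_mx.
Qed.

End Wedge.

(** * The pointwise identity for the complex volume form *)

Section CubicIdentity.
Variables (R : realType) (K : numFieldType) (n : nat).

Lemma skew_form1 (f : 'M[R]_(1, n) -> K) : skew_form f.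
Proof. by move=> s A; rewrite permS1 row_perm1 odd_perm1 mul1r. Qed.

Lemma ewedge11 (a b : eform R K n 1) x (A : 'M[R]_(2, n)) :
  ewedge a b x A = a x (row 0 A) * b x (row 1 A) - a x (row 1 A) * b x (row 0 A).
Proof.
have := @ewedge1r R K n 1 a b x A (@skew_form1 _); rewrite castmx_id => ->.
have row'E (i : 'I_2) : row' i A = row (lift i ord0) A.
  by apply/rowP => j; rewrite !mxE; congr (A (lift _ _) _); rewrite ord1.
rewrite !big_ord_recl big_ord0 !row'E /=.
have -> : lift ord0 ord0 = 1 :> 'I_2 by apply: val_inj.
have -> : lift 1 ord0 = 0 :> 'I_2 by apply: val_inj.
by rewrite /bump /= expr1 sqrrN expr1n mulN1r mul1r addr0 addrC.
Qed.

Lemma ewedge21 (a : eform R K n 2) (b : eform R K n 1) x (A : 'M[R]_(3, n)) :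
  skew_form (a x) ->
  ewedge a b x A =
  \sum_(i < 3) (-1) ^+ i * (a x (row' i A) * b x (row i A)).
Proof.
move=> ska; have := @ewedge1r R K n 2 a b x A ska; rewrite castmx_id => ->.
by apply: eq_bigr => i _; rewrite exprD sqrrN expr1n mul1r.
Qed.

(* [(u ∧ v ∧ w) ∧ β = 0] for [β] in the span of [u], [v] and [w], expanded along
   the argument of [β]. *)
Lemma decomposable3_wedge_span (u v w : eform R K n 1) (p q r : K) x (A : 'M[R]_(4, n)) :
  \sum_(i < 4) (-1) ^+ i * (ewedge (ewedge u v) w x (row' i A) *
    (p * u x (row i A) + q * v x (row i A) + r * w x (row i A))) = 0.
Proof.
have ordE : [/\ (0 : 'I_2) = ord0 & (1 : 'I_2) = lift ord0 ord0].
  by split; apply: val_inj.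
(* [inord] names a row by its natural number, so that different nestings of [lift] become the same
   atom for [ring]. *)
have rowE (i : 'I_4) : row i A = row (inord i) A by rewrite inord_val.
under eq_bigr => i _.
  rewrite ewedge21; last exact: (@ewedge_skew _ _ _ 1 1).
  under eq_bigr => j _ do rewrite ewedge11 !row_row' !(rowE (lift _ _)) /=.
  rewrite (rowE i).
over.
rewrite !big_ord_recl !big_ord0 /bump /=.
ring.
Qed.
End CubicIdentity.

Lemma ReM (R : rcfType) (z w : R[i]) :
  complex.Re (z * w) = complex.Re z * complex.Re w - complex.Im z * complex.Im w.
Proof. by case: z w => [a b] [c d]. Qed.

Lemma ReD (R : rcfType) (z w : R[i]) :
  complex.Re (z + w) = complex.Re z + complex.Re w.
Proof. by case: z w => [a b] [c d]. Qed.

Lemma Re_signM (R : rcfType) k (z : R[i]) :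
  complex.Re ((-1) ^+ k * z) = (-1) ^+ k * complex.Re z.
Proof.
rewrite -signr_odd -[in RHS]signr_odd; case: (odd k); last by rewrite !mul1r.
by case: z => a b; rewrite !mulN1r.
Qed.

Lemma Re_sum (R : rcfType) m (z : 'I_m -> R[i]) :
  complex.Re (\sum_i z i) = \sum_i complex.Re (z i).
Proof. by elim: m z => [|m IH] z; rewrite ?big_ord0 // !big_ord_recl ReD IH. Qed.

(* Real part of [|X|^2 Psi = (X _| Psi) /\ (X^flat + i X _| omega)]. *)
Lemma adapted_coframe_reduction (R : realType) (omega : eform R R 6 2)
    (Psi : eform R R[i] 6 3) (V : set 'rV[R]_6) (e : nat -> eform R R 6 1)
    (x X : 'rV[R]_6) (A : 'M[R]_(3, 6)) :
  adapted_coframe omega Psi V e -> V x ->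
  let g v := \sum_(1 <= i < 7) e i x X * e i x v in
  g X * complex.Re (Psi x A) =
  \sum_(j < 3) (-1) ^+ j *
    (complex.Re (Psi x (col_mx X (row' j A) : 'M[R]_(1 + 2, 6))) * g (row j A) -
     complex.Im (Psi x (col_mx X (row' j A) : 'M[R]_(1 + 2, 6))) *
       omega x (col_mx X (row j A) : 'M[R]_(1 + 1, 6))).
Proof.
move=> [_ omegaE PsiE] Vx g.
pose th k := ecomplex (e k) (e (k + 3)%N).
(* The coefficients are the conjugates of theta^k(X): the real part of conj(theta^k(X)) theta^k sums
   to X^flat, its imaginary part to X _| omega. *)
pose c k := Complex (e k x X) (- e (k + 3)%N x X).
pose C := col_mx X A : 'M[R]_(1 + 3, 6).
pose b (v : 'rV[R]_6) := c 1%N * th 1%N x v + c 2%N * th 2%N x v + c 3%N * th 3%N x v.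
have bE v : b v = Complex (g v) (omega x (col_mx X v : 'M[R]_(1 + 1, 6))).
  have E1 : 1 = lift ord0 ord0 :> 'I_2 by apply: val_inj.
  have rv : row ord0 v = v by apply/rowP => j; rewrite mxE.
  rewrite omegaE // !ewedge11 E1 row0_col_mx row_lift0_col_mx rv /g unlock /= /b /c /th /ecomplex.
  by apply/eqP; rewrite eq_complex /=; apply/andP; split; apply/eqP; ring.
have := @decomposable3_wedge_span R R[i] 6 (th 1%N) (th 2%N) (th 3%N)
  (c 1%N) (c 2%N) (c 3%N) x C.
under eq_bigr => i _.
  rewrite -PsiE // -/(b _).
over.
(* The first term evaluates the 1-form on X itself, which gives |X|^2 since omega(X, X) = 0; the
   others contain X _| Psi. *)
rewrite big_ord_recl row0_col_mx row'0_col_mx.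
under eq_bigr => i _ do rewrite row_lift0_col_mx row'_lift0_col_mx !bE.
have oXX : omega x (col_mx X X : 'M[R]_(1 + 1, 6)) = 0.
  have E1 : 1 = lift ord0 ord0 :> 'I_2 by apply: val_inj.
  have rX : row ord0 X = X by apply/rowP => j; rewrite mxE.
  by rewrite omegaE // !ewedge11 E1 row0_col_mx row_lift0_col_mx rX !subrr !addr0.
move=> /(congr1 (@complex.Re R)); rewrite bE oXX ReD Re_sum mul1r ReM mulr0 subr0.
move=> /eqP; rewrite addr_eq0 => /eqP; rewrite mulrC => ->.
rewrite -sumrN; apply: eq_bigr => i _.
by rewrite Re_signM ReM lift0 exprS mulN1r mulNr opprK.
Qed.

(** * Symmetry of second derivatives *)

Section SecondDerivative.
Variables (R : realType) (V : normedModType R).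
Implicit Types (g : V -> R) (x y u v : V).

Lemma is_derive_line g y u (s : R) :
  derivable g (s *: u + y) u ->
  is_derive s 1 (fun r : R => g (r *: u + y)) ('D_u g (s *: u + y)).
Proof.
move=> gu.
have E : (fun h : R => h^-1 *:
      ((fun r : R => g (r *: u + y)) (h *: (1 : R) + s) - g (s *: u + y))) =
    (fun h => h^-1 *: (g (h *: u + (s *: u + y)) - g (s *: u + y))).
  by apply/funext => h; rewrite [h *: 1]mulr1 scalerDl addrA.
by apply: DeriveDef; rewrite /derivable /derive E.
Qed.

Lemma mean_value_line g y u (h : R) : 0 < h ->
  (forall s, 0 <= s <= h -> derivable g (s *: u + y) u) ->
  exists2 s, 0 <= s <= h & g (h *: u + y) - g y = h * 'D_u g (s *: u + y).
Proof.
move=> h0 gu.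
have d s : s \in `[0, h]%R -> is_derive s 1 (fun r : R => g (r *: u + y)) ('D_u g (s *: u + y)).
  by rewrite in_itv /= => /gu; exact: is_derive_line.
have c : {within `[0, h], continuous (fun r : R => g (r *: u + y))}.
  by apply: derivable_within_continuous => r /d [].
have d' s : s \in `]0, h[%R -> is_derive s 1 (fun r : R => g (r *: u + y)) ('D_u g (s *: u + y)).
  by move=> sh; apply: d; exact: subset_itv_oo_cc sh.
have [s sh E] := MVT_segment (ltW h0) d' c.
exists s; first by move: sh; rewrite in_itv.
by move: E; rewrite scale0r add0r subr0 mulrC.
Qed.

(** Mean value theorem twice: along [u] for the increment [G], then along [v] for ['D_u g]. The
    left-hand side is symmetric in [u] and [v], the right-hand side is not. *)
Lemma second_difference g x u v (h : R) : 0 < h ->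
  (forall a b, 0 <= a <= h -> 0 <= b <= h ->
     derivable g (a *: u + (b *: v + x)) u /\
     derivable ('D_u g) (a *: u + (b *: v + x)) v) ->
  exists a b, [/\ 0 <= a <= h, 0 <= b <= h &
    g (h *: u + (h *: v + x)) - g (h *: v + x) - (g (h *: u + x) - g x) =
    h * (h * 'D_v ('D_u g) (a *: u + (b *: v + x)))].
Proof.
move=> h0 gd.
have hh : 0 <= h <= h by rewrite lexx ltW.
have h00 : 0 <= (0 : R) <= h by rewrite lexx ltW.
pose G y := g (y + h *: v) - g y.
have dG a : 0 <= a <= h -> is_derive (a *: u + x) u G
    ('D_u g (a *: u + (h *: v + x)) - 'D_u g (a *: u + x)).
  move=> ah.
  have d1 : derivable g (a *: u + (h *: v + x)) u by exact: proj1 (gd a h ah hh).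
  have d0 : derivable g (a *: u + x) u.
    by case: (gd a 0 ah h00); rewrite scale0r add0r.
  apply: is_deriveB; last exact: derivableP.
  have E : (fun k : R => k^-1 *: (g (k *: u + (a *: u + x) + h *: v) - g (a *: u + x + h *: v))) =
     (fun k => k^-1 *: (g (k *: u + (a *: u + (h *: v + x))) - g (a *: u + (h *: v + x)))).
    apply/funext => k.
    by rewrite -!addrA [x + _]addrC.
  apply: DeriveDef; first by rewrite /derivable E; exact: d1.
  by rewrite /derive E.
have [a ah Ea] := @mean_value_line G x u h h0 (fun a ah => @ex_derive _ _ _ _ _ _ _ (dG a ah)).
have dGu b : 0 <= b <= h -> derivable ('D_u g) (b *: v + (a *: u + x)) v.
  by move=> bh; case: (gd a b ah bh) => _; rewrite addrCA.
have [b bh Eb] := mean_value_line h0 dGu.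
exists a, b; split=> //; rewrite [a *: u + _]addrCA -Eb [h *: v + (a *: u + _)]addrCA.
have [_ <-] := dG a ah; rewrite -Ea /G -[h *: u + x + _]addrA [x + _]addrC.
ring.
Qed.

(* By [second_difference], in every neighbourhood of [x] there are two points at
   which the two mixed derivatives take the same value. *)
Lemma derive_comm g x u v :
  (\forall y \near x, derivable g y u /\ derivable ('D_u g) y v) ->
  (\forall y \near x, derivable g y v /\ derivable ('D_v g) y u) ->
  {for x, continuous ('D_v ('D_u g))} -> {for x, continuous ('D_u ('D_v g))} ->
  'D_v ('D_u g) x = 'D_u ('D_v g) x.
Proof.
move=> dgu dgv cvu cuv; apply: contrapT => /eqP ne.
(* Half the gap: a common value lying within [e] of both mixed derivatives at [x] is then
   impossible. *)
pose e := `|'D_v ('D_u g) x - 'D_u ('D_v g) x| / 2.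
have e0 : 0 < e by rewrite divr_gt0// normr_gt0 subr_eq0.
have n1 : \forall y \near x, `|'D_v ('D_u g) x - 'D_v ('D_u g) y| < e.
  by move/cvgrPdist_lt : cvu; apply.
have n2 : \forall y \near x, `|'D_u ('D_v g) x - 'D_u ('D_v g) y| < e.
  by move/cvgrPdist_lt : cuv; apply.
have : \forall y \near x, [/\ derivable g y u /\ derivable ('D_u g) y v,
    derivable g y v /\ derivable ('D_v g) y u, `|'D_v ('D_u g) x - 'D_v ('D_u g) y| < e &
    `|'D_u ('D_v g) x - 'D_u ('D_v g) y| < e].
  by apply: filterS3 dgu dgv (filterI n1 n2) => y ? ? [].
move=> /nbhs_ballP [r /= r0 Br].
(* The parallelogram with sides h u and h v stays within h (|u| + |v|) < r of [x]; the summand 1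
   keeps [c] positive when u = v = 0. *)
pose c := `|u| + `|v| + 1.
have c0 : 0 < c by rewrite ltr_wpDl // addr_ge0.
pose h := r / c.
have h0 : 0 < h by rewrite divr_gt0.
have Bin w1 w2 (a b : R) : `|w1| + `|w2| = `|u| + `|v| ->
    0 <= a <= h -> 0 <= b <= h -> ball x r (a *: w1 + (b *: w2 + x)).
  move=> ww /andP[a0 ah] /andP[b0 bh]; rewrite -ball_normE /= distrC addrA addrK.
  apply: (le_lt_trans (ler_normD _ _)); rewrite !normrZ !ger0_norm //.
  apply: (@le_lt_trans _ _ (h * (`|w1| + `|w2|))).
    by rewrite mulrDr lerD // ler_wpM2r.
  by rewrite ww /h mulrAC ltr_pdivrMr // ltr_pM2l // /c ltrDl.
have [a [b [ah bh E1]]] : exists a b, [/\ 0 <= a <= h, 0 <= b <= h &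
    g (h *: u + (h *: v + x)) - g (h *: v + x) - (g (h *: u + x) - g x) =
    h * (h * 'D_v ('D_u g) (a *: u + (b *: v + x)))].
  apply: second_difference h0 _ => a b ah bh.
  have [d _ _ _] := Br _ (Bin u v a b erefl ah bh); exact: d.
have [a' [b' [ah' bh' E2]]] : exists a b, [/\ 0 <= a <= h, 0 <= b <= h &
    g (h *: v + (h *: u + x)) - g (h *: u + x) - (g (h *: v + x) - g x) =
    h * (h * 'D_u ('D_v g) (a *: v + (b *: u + x)))].
  apply: second_difference h0 _ => a' b' ah' bh'.
  have [_ d _ _] := Br _ (Bin v u a' b' (addrC _ _) ah' bh'); exact: d.
have [_ _ l1 _] := Br _ (Bin u v a b erefl ah bh).
have [_ _ _ l2] := Br _ (Bin v u a' b' (addrC _ _) ah' bh').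
have E : 'D_v ('D_u g) (a *: u + (b *: v + x)) = 'D_u ('D_v g) (a' *: v + (b' *: u + x)).
  have hn : h != 0 by rewrite gt_eqF.
  have Ep : h *: u + (h *: v + x) = h *: v + (h *: u + x) by rewrite addrCA.
  rewrite Ep in E1.
  have E12 : h * (h * 'D_v ('D_u g) (a *: u + (b *: v + x))) =
             h * (h * 'D_u ('D_v g) (a' *: v + (b' *: u + x))).
    apply: etrans (esym E1) _; apply: etrans _ E2.
    move: (g _) (g (h *: v + x)) (g (h *: u + x)) (g x) => A B C D.
    ring.
  by move/(mulfI hn)/(mulfI hn): E12.
rewrite -E distrC in l2.
have := ler_distD ('D_v ('D_u g) (a *: u + (b *: v + x))) ('D_v ('D_u g) x) ('D_u ('D_v g) x).
move/le_lt_trans => /(_ _ (ltrD l1 l2)).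
by rewrite /e -splitr ltxx.
Qed.
End SecondDerivative.

Lemma derive_coord (R : realType) (V : normedModType R) n (f : V -> 'rV[R]_n)
    (x v : V) (j : 'I_n) :
  derivable f x v -> 'D_v (fun y => f y ord0 j) x = 'D_v f x ord0 j.
Proof. by move=> df; rewrite (derive_mx df) mxE. Qed.

(** Coordinatewise [derive_comm]. The coordinate formulas hold on [U], and a second derivative at y
    requires them near y; hence the restriction to points of which [U] is a neighbourhood. *)
Lemma smooth_on_derive_comm (R : realType) (V : normedModType R) n
    (U : set V) (f : V -> 'rV[R]_n) (x u v : V) :
  smooth_on U f -> nbhs x U -> 'D_v ('D_u f) x = 'D_u ('D_v f) x.
Proof.
move=> sf Ux; apply/rowP => j.
have d0 y a : U y -> derivable f y a by move=> /(sf [::]); exact: diff_derivable.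
have d1 y a b : U y -> derivable ('D_a f) y b.
  by move=> /(sf [:: a]); exact: diff_derivable.
pose g y := f y ord0 j.
have gU y a : U y -> 'D_a g y = 'D_a f y ord0 j by move=> Uy; rewrite (derive_coord _ (d0 y a Uy)).
have nU : \forall y \near x, nbhs y U by exact: nbhs_interior.
have dg y a : U y -> derivable g y a.
  by move=> Uy; have /derivable_mxP := d0 y a Uy; apply.
have gN (y a : V) : nbhs y U -> \forall z \near y, 'D_a f z ord0 j = 'D_a g z.
  by move=> yU; near=> z; rewrite gU //; near: z.
have dDg (y a b : V) : nbhs y U -> derivable ('D_a g) y b.
  move=> yU; apply: (near_eq_derivable (gN y a yU)).
  by have /derivable_mxP := d1 y a b (nbhs_singleton yU); apply.
have DDg (y a b : V) : nbhs y U -> 'D_b ('D_a g) y = 'D_b ('D_a f) y ord0 j.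
  move=> yU; rewrite -(near_eq_derive b (gN y a yU)) derive_coord //.
  exact: d1 (nbhs_singleton yU).
have cg a b : {for x, continuous ('D_b ('D_a g))}.
  have cf : (fun y => 'D_b ('D_a f) y ord0 j) @ x --> 'D_b ('D_a f) x ord0 j.
    have := differentiable_continuous (sf [:: b; a] x (nbhs_singleton Ux)).
    move=> c.
    apply: (@cvg_comp _ _ _ ('D_b ('D_a f)) (fun M : 'rV[R]_n => M ord0 j) _ _ _ c).
    exact: (differentiable_continuous (differentiable_coord _ _ _)).
  change ('D_b ('D_a g) @ x --> 'D_b ('D_a g) x).
  rewrite DDg //; apply: cvg_trans cf; apply: near_eq_cvg.
  by apply: filterS nU => y yU; rewrite DDg.
have dd (a b : V) : \forall y \near x, derivable g y a /\ derivable ('D_a g) y b.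
  by apply: filterS nU => y yU; split; [exact: dg (nbhs_singleton yU) | exact: dDg].
apply: etrans (esym (DDg x u v Ux)) _; apply: etrans _ (DDg x v u Ux).
exact: derive_comm (dd u v) (dd v u) (cg u v) (cg v u).
Unshelve. all: by end_near. Qed.

(** * Derivatives of multilinear forms *)

Lemma is_derive_sum_pt (R : realType) (V : normedModType R) (I : finType)
    (h : I -> V -> R) (dh : I -> R) (x v : V) :
  (forall i, is_derive x v (h i) (dh i)) ->
  is_derive x v (fun y => \sum_i h i y) (\sum_i dh i).
Proof.
move=> hd; rewrite -fct_sumE.
by elim/big_ind2 : _ => // [|? ? ? ? ? ?]; [exact: is_derive_cst | exact: is_deriveD].
Qed.

Lemma is_derive_comp_diff (R : realType) (U V W : normedModType R) (f : U -> V)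
    (g : V -> W) (x v : U) :
  differentiable f x -> differentiable g (f x) ->
  is_derive x v (fun y => g (f y)) ('D_('D_v f x) g (f x)).
Proof.
move=> df dg; have dgf := differentiable_comp df dg.
apply: DeriveDef; first exact: diff_derivable.
by rewrite !deriveE // -[fun y => _]/(g \o f) diff_comp.
Qed.

Lemma row_set0 (R : Type) (k n : nat) (r : 'rV[R]_n) (A : 'M[R]_(1 + k, n)) :
  row_set ord0 r A = col_mx r (row' ord0 A).
Proof.
by rewrite (eq_col_mx_row (row_row_set ord0 r A)) row'_row_set.
Qed.

Section MultilinearDerivative.
Variables (R : realType) (n : nat).

Lemma multilinear_col_mx k (w : 'M[R]_(1 + k, n) -> R) (r : 'rV[R]_n) :
  multilinear_form w -> multilinear_form (fun B : 'M[R]_(k, n) => w (col_mx r B)).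
Proof.
have rE B B' i : row' i B = row' i B' ->
    row' (lift ord0 i : 'I_(1 + k)) (col_mx r B) = row' (lift ord0 i) (col_mx r B').
  move=> BB; apply: row'_of_rows => m.
  case: (unliftP ord0 m) => [j|] -> mi; last by rewrite !row0_col_mx.
  rewrite !row_lift0_col_mx; apply: rows_of_row' BB _.
  by rewrite (inj_eq (lift_inj (h := ord0))) in mi.
move=> mw A B C i b c Ai BA CA.
by apply: (mw _ _ _ (lift ord0 i)); rewrite ?row_lift0_col_mx //; apply: rE.
Qed.

Lemma multilinear_expand_row0 k (w : 'M[R]_(1 + k, n) -> R) (A : 'M[R]_(1 + k, n)) :
  multilinear_form w ->
  w A = \sum_j A ord0 j * w (col_mx (delta_mx 0 j) (row' ord0 A)).
Proof.
move=> mw; rewrite -{1}(row_set_id ord0 A) (matrix_sum_delta (row ord0 A)).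
rewrite big_ord1 multilinear_row_set_sum //.
by apply: eq_bigr => j _; rewrite mxE row_set0.
Qed.

Variables (V : normedModType R) (f : V -> 'rV[R]_n) (x v : V).
Hypothesis df : differentiable f x.

(** Product rule with coefficients and arguments both moving. [W] is differentiable only for frozen
    arguments, so the first row is expanded in the standard basis, with induction on the number of
    rows. *)
Lemma is_derive_multilinear k (W : eform R R n k) (C : V -> 'M[R]_(k, n)) :
  (\forall z \near f x, multilinear_form (W z)) ->
  (forall B, differentiable (fun z => W z B) (f x)) ->
  (forall i j, derivable (fun y => C y i j) x v) ->
  is_derive x v (fun y => W (f y) (C y))
    ('D_('D_v f x) (fun z => W z (C x)) (f x) +
     \sum_i W (f x) (row_set i (\row_j 'D_v (fun y => C y i j) x) (C x))).
Proof.
elim: k W C => [|k IH] W C mW dW dC.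
  rewrite big_ord0 addr0.
  have -> : (fun y => W (f y) (C y)) = (fun y => W (f y) (C x)).
    by apply/funext => y; rewrite (flatmx0 (C y)) (flatmx0 (C x)).
  exact: is_derive_comp_diff.
have mWfx := nbhs_singleton mW.
pose Wd j : eform R R n k := fun z B => W z (col_mx (delta_mx 0 j) B : 'M[R]_(1 + k, n)).
pose C' y := row' ord0 (C y).
have dj j : is_derive x v (fun y => Wd j (f y) (C' y))
    ('D_('D_v f x) (fun z => Wd j z (C' x)) (f x) +
     \sum_i Wd j (f x) (row_set i (\row_l 'D_v (fun y => C' y i l) x) (C' x))).
  apply: IH.
  - by apply: filterS mW => z; exact: multilinear_col_mx.
  - by move=> B; exact: dW.
  - move=> i l; rewrite (_ : (fun y => _) = (fun y => C y (lift ord0 i) l)) //.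
    by apply/funext => y; rewrite mxE.
have E : \forall y \near x, \sum_j C y ord0 j * Wd j (f y) (C' y) = W (f y) (C y).
  have /= cf := differentiable_continuous df.
  have : \forall y \near x, multilinear_form (W (f y)) by exact: cf _ mW.
  by apply: filterS => y mWy; rewrite [RHS](multilinear_expand_row0 _ mWy).
apply: (near_eq_is_derive E).
have D := is_derive_sum_pt (fun j => is_deriveM (derivableP (dC ord0 j)) (dj j)).
apply: (@is_derive_eq _ _ _ _ _ _ _ _ D).
(* The derivatives of the entries of row 0 make up slot [ord0]; the inductive hypothesis supplies
   the derivative of [W] and the other slots. *)
rewrite big_split /= big_ord_recl addrC addrCA; congr (_ + _).
  rewrite multilinear_expand_row0 // row'_row_set.
  by apply: eq_bigr => j _; rewrite [LHS]mulrC row_setE mxE.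
under eq_bigr => j _ do rewrite scalerDr.
rewrite big_split; congr (_ + _).
  have D0 := is_derive_sum_pt (fun j => is_deriveZ (C x ord0 j)
    (derivableP (@diff_derivable _ _ _ _ _ ('D_v f x)
      (dW (col_mx (delta_mx 0 j) (C' x) : 'M[R]_(1 + k, n)))))).
  apply/esym; have [_ <-] := D0; apply: near_eq_derive.
  by apply: filterS mW => z /= mz; rewrite multilinear_expand_row0.
under eq_bigr => j _ do rewrite scaler_sumr.
rewrite exchange_big; apply: eq_bigr => i _ /=.
rewrite multilinear_expand_row0 //; apply: eq_bigr => j _.
have -> : row' ord0 (row_set (lift ord0 i) (\row_j 'D_v (fun y => C y (lift ord0 i) j) x) (C x)) =
    row_set i (\row_l 'D_v (fun y => C' y i l) x) (C' x).
  apply/row_matrixP => m; rewrite row_row' !rowK (inj_eq (lift_inj (h := ord0))).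
  case: eqP => _; last by rewrite /C' row_row'.
  apply/rowP => l; rewrite !mxE; congr ('D_v _ x); apply/funext => y.
  by rewrite mxE.
by rewrite row_set_neqE.
Qed.
End MultilinearDerivative.

(** * The exterior derivative *)

Section ExteriorDerivative.
Variables (R : realType) (n : nat).

Definition ederivable k (w : eform R R n k) x : Prop :=
  forall B v, derivable (fun y => w y B) x v.

Lemma near_eq_ediff k (w w' : eform R R n k) x A :
  (forall B, \forall y \near x, w y B = w' y B) -> ediff w x A = ediff w' x A.
Proof.
by move=> ww; apply: eq_bigr => i _; congr (_ * _); apply: near_eq_derive.
Qed.

(** Brings [d] into the calculus of permutation sums; the factor k! appears because [w] is already
    skew in the remaining rows. Skewness of dw follows at once. *)
Lemma ediff_alternation k (w : eform R R n k) x A :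
  (\forall y \near x, skew_form (w y)) -> ederivable w x ->
  k`!%:R * ediff w x A =
  alternation (fun B : 'M[R]_(k.+1, n) =>
    'D_(row ord0 B) (fun y => w y (row' ord0 B)) x) A.
Proof.
move=> skw dw; rewrite alternation_recl mulr_sumr; apply: eq_bigr => i _.
rewrite mulrCA; congr (_ * _).
rewrite (eq_alternation (G := fun B => 'D_(row i A) (fun y => w y B) x)); last first.
  by move=> B; rewrite row0_col_mx row'0_col_mx.
rewrite alternation_of_skew // => s B.
have [_ E] := is_deriveZ ((-1) ^+ s) (derivableP (dw B (row i A))).
apply: etrans _ E; apply: near_eq_derive.
by apply: filterS skw => y ->.
Qed.

Lemma ediff_skew k (w : eform R R n k) x :
  (\forall y \near x, skew_form (w y)) -> ederivable w x -> skew_form (ediff w x).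
Proof.
move=> skw dw s A.
have k0 : k`!%:R != 0 :> R by rewrite pnatr_eq0 -lt0n fact_gt0.
by apply: (mulfI k0); rewrite mulrCA !ediff_alternation // alternation_skew.
Qed.

Lemma ediffD k (w w' : eform R R n k) x A : ederivable w x -> ederivable w' x ->
  ediff (fun y B => w y B + w' y B) x A = ediff w x A + ediff w' x A.
Proof.
move=> dw dw'; rewrite -big_split; apply: eq_bigr => i _ /=.
by rewrite -mulrDr deriveD.
Qed.

Lemma ediffN k (w : eform R R n k) x A : ederivable w x ->
  ediff (fun y B => - w y B) x A = - ediff w x A.
Proof.
move=> dw; rewrite -sumrN; apply: eq_bigr => i _ /=.
by rewrite -mulrN deriveN.
Qed.

Lemma ederivableN k (w : eform R R n k) x :
  ederivable w x -> ederivable (fun y B => - w y B) x.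
Proof. by move=> dw B v; exact: derivableN. Qed.

Lemma is_derive_ewedge k l (a : eform R R n k) (b : eform R R n l) x v A :
  ederivable a x -> ederivable b x ->
  is_derive x v (fun y => ewedge a b y A) ((k`! * l`!)%:R^-1 * alternation
    (fun B => 'D_v (fun y => a y (usubmx B) * b y (dsubmx B)) x) A).
Proof.
move=> da db.
have d (s : 'S_(k + l)) : is_derive x v
    (fun y => (-1) ^+ s * (a y (usubmx (row_perm s A)) * b y (dsubmx (row_perm s A))))
    ((-1) ^+ s * 'D_v (fun y => a y (usubmx (row_perm s A)) * b y (dsubmx (row_perm s A))) x).
  apply: is_deriveZ; apply: derivableP.
  exact: (@derivableM _ _ (fun y => a y (usubmx (row_perm s A)))
                      (fun y => b y (dsubmx (row_perm s A)))).
by apply: is_deriveZ; exact: is_derive_sum_pt.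
Qed.

Lemma ederivable_ewedge k l (a : eform R R n k) (b : eform R R n l) x :
  ederivable a x -> ederivable b x -> ederivable (ewedge a b) x.
Proof. by move=> da db B v; have [] := is_derive_ewedge v B da db. Qed.

(** The product rule under the alternation splits it into [Fa] and [Fb]. Expanding [ediff a] inside
    the wedge gives k+1 alternations, all equal to that of [Fa] by [alternation_cycle], which turns
    k! into (k+1)!; likewise for [Fb]. The cast only compares [(k + l).+1] with [k + l.+1]. *)
Lemma ediff_ewedge k l (a : eform R R n k) (b : eform R R n l) x
    (A : 'M[R]_((k + l).+1, n)) :
  ederivable a x -> ederivable b x ->
  ediff (ewedge a b) x A = ewedge (ediff a) b x A +
    (-1) ^+ k * ewedge a (ediff b) x (castmx (esym (addnS k l), erefl n) A).
Proof.
move=> da db.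
pose Fa (B : 'M[R]_(1 + (k + l), n)) :=
  'D_(row ord0 B) (fun y => a y (usubmx (row' ord0 B))) x * b x (dsubmx (row' ord0 B)).
pose Fb (B : 'M[R]_(1 + (k + l), n)) :=
  a x (usubmx (row' ord0 B)) * 'D_(row ord0 B) (fun y => b y (dsubmx (row' ord0 B))) x.
have -> : ediff (ewedge a b) x A =
    (k`! * l`!)%:R^-1 * (alternation Fa A + alternation Fb A).
  rewrite -alternationD alternation_recl mulr_sumr; apply: eq_bigr => i _.
  rewrite mulrCA; congr (_ * _).
  have [_ ->] := is_derive_ewedge (row i A) (row' i A) da db; congr (_ * _).
  apply: eq_alternation => B; rewrite /Fa /Fb row0_col_mx row'0_col_mx.
  rewrite -[fun y => _]/((fun y => a y (usubmx B)) * (fun y => b y (dsubmx B))).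
  have [_ E] := is_deriveM (derivableP (da (usubmx B) (row i A)))
                          (derivableP (db (dsubmx B) (row i A))).
  by apply: etrans E _; rewrite addrC; congr (_ + _); exact: mulrC.
have -> : ewedge (ediff a) b x A = (k`! * l`!)%:R^-1 * alternation Fa A.
  rewrite ewedgeE.
  rewrite (eq_alternation (G := fun B => \sum_(i < k.+1) (-1) ^+ i *
      Fa (col_mx (row (lshift l i) B) (row' (lshift l i) B : 'M[R]_(k + l, n))))); last first.
    move=> B; rewrite /ediff mulr_suml; apply: eq_bigr => i _.
    rewrite /Fa row0_col_mx row'0_col_mx mulrA; congr (_ * _ * _).
      have -> : row i (usubmx B) = row (lshift l i) B by apply/rowP => j; rewrite !mxE.
      congr ('D_(row (lshift l i) B) _ x); apply/funext => y; congr (a y _).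
      by apply/matrixP => p q; rewrite !mxE; congr (B _ _); apply: val_inj.
    congr (b x _); apply/matrixP => p q; rewrite !mxE; congr (B _ _); apply: val_inj.
    by rewrite /= /bump (leq_trans (leq_ord i)) ?leq_addr.
  rewrite alternation_sum.
  under eq_bigr => i _.
    rewrite alternationZ (alternation_cycle Fa (lshift l i)) /= mulrA -exprD addnn.
    rewrite -signr_odd odd_double expr0 mul1r.
  over.
  rewrite sumr_const card_ord -[_ *+ k.+1]mulr_natl factS -mulnA natrM invfM.
  rewrite mulrACA.
  by rewrite mulVf ?mul1r // pnatr_eq0.
rewrite mulrDr; congr (_ + _).
(* Row j of the second block is row k + j of the whole. Its cycle has sign (-1)^(k+j): the part
   (-1)^j cancels that of [ediff b], and (-1)^k is the sign in the Leibniz rule. *)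
pose j' (j : 'I_l.+1) : 'I_(1 + (k + l)) := cast_ord (addnS k l) (rshift k j).
rewrite ewedgeE alternation_cast.
rewrite [in RHS](eq_alternation (G := fun B => \sum_(j < l.+1) (-1) ^+ j *
    Fb (col_mx (row (j' j) B) (row' (j' j) B : 'M[R]_(k + l, n))))); last first.
  move=> B /=. rewrite /ediff mulr_sumr; apply: eq_bigr => j _.
  rewrite /Fb row0_col_mx row'0_col_mx mulrCA; congr (_ * (_ * _)).
    congr (a x _); apply/matrixP => p q; rewrite !mxE castmxE /=.
    congr (B _ _); apply: val_inj => //=.
    by rewrite /bump leqNgt (leq_trans (ltn_ord p)) ?leq_addr.
  have -> : row j (dsubmx (castmx (esym (addnS k l), erefl n) B)) = row (j' j) B.
    by apply/rowP => q; rewrite !mxE castmxE; congr (B _ _); apply: val_inj.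
  congr ('D_(row (j' j) B) _ x); apply/funext => y; congr (b y _).
  apply/matrixP => p q; rewrite !mxE castmxE /=; congr (B _ _); apply: val_inj => //=.
  by rewrite /bump leq_add2l addnCA.
rewrite alternation_sum.
under eq_bigr => j _.
  rewrite alternationZ (alternation_cycle Fb (j' j)) /= mulrA -exprD addnCA addnn.
  rewrite exprD -[(-1) ^+ j.*2]signr_odd odd_double expr0 mulr1.
over.
rewrite /= sumr_const card_ord -[_ *+ l.+1]mulr_natl factS mulnCA [in RHS]natrM invfM.
rewrite [X in _ = _ * X]mulrACA mulVf ?pnatr_eq0 // mul1r [RHS]mulrCA.
congr (_ * _); rewrite mulrA.
by rewrite -exprD addnn -[(-1) ^+ k.*2]signr_odd odd_double expr0 mul1r.
Qed.

End ExteriorDerivative.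

(** * Pullbacks *)

Section Pullback.
Variables (R : realType) (m n : nat) (f : 'rV[R]_m -> 'rV[R]_n).

Definition epull (K : Type) k (w : eform R K n k) : eform R K m k :=
  fun y A => w (f y) (A *m 'J f y).

Lemma row'_mul k p (A : 'M[R]_(k, m)) (B : 'M[R]_(m, p)) i :
  row' i (A *m B) = row' i A *m B.
Proof.
by apply/matrixP => a b; rewrite !mxE; apply: eq_bigr => c _; rewrite mxE.
Qed.

Lemma row_perm_mul k p (s : 'S_k) (A : 'M[R]_(k, m)) (B : 'M[R]_(m, p)) :
  row_perm s (A *m B) = row_perm s A *m B.
Proof.
by apply/matrixP => a b; rewrite !mxE; apply: eq_bigr => c _; rewrite mxE.
Qed.

Lemma epull_ewedge (K : fieldType) k l (a : eform R K n k) (b : eform R K n l) x A :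
  epull (ewedge a b) x A = ewedge (epull a) (epull b) x A.
Proof.
rewrite /epull /ewedge; congr (_ * _); apply: eq_bigr => s _.
rewrite row_perm_mul; congr (_ * (a _ _ * b _ _)).
  by apply/matrixP => i j; rewrite !mxE; apply: eq_bigr => c _; rewrite !mxE.
by apply/matrixP => i j; rewrite !mxE; apply: eq_bigr => c _; rewrite !mxE.
Qed.

Variables (U : set 'rV[R]_m) (x : 'rV[R]_m).
Hypotheses (sf : smooth_on U f) (Ux : nbhs x U).

Variables (k : nat) (w : eform R R n k).
Hypothesis mw : \forall z \near f x, multilinear_form (w z).
Hypothesis dw : forall B, differentiable (fun z => w z B) (f x).

(** The rows of [A *m 'J f y] are the directional derivatives of [f] along the rows of [A], so
    moving arguments contribute second derivatives of [f]. Passing through these rows ([C]) also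
    matches [smooth_on], which speaks of directional derivatives. *)
Lemma is_derive_epull (A : 'M[R]_(k, m)) (v : 'rV[R]_m) :
  is_derive x v (fun y => epull w y A)
    ('D_(v *m 'J f x) (fun z => w z (A *m 'J f x)) (f x) +
     \sum_i w (f x) (row_set i ('D_v ('D_(row i A) f) x) (A *m 'J f x))).
Proof.
have dfU y : U y -> differentiable f y by exact: (sf [::]).
have Uxx := nbhs_singleton Ux.
pose C (y : 'rV[R]_m) : 'M[R]_(k, n) := \matrix_i ('D_(row i A) f y).
have CE y : U y -> C y = A *m 'J f y.
  by move=> Uy; apply/row_matrixP => i; rewrite rowK row_mul deriveEjacobian //; exact: dfU.
have dC i j : derivable (fun y => C y i j) x v.
  have dD : derivable ('D_(row i A) f) x v by apply: diff_derivable; exact: (sf [:: row i A]).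
  have /derivable_mxP /(_ ord0 j) := dD.
  by rewrite (_ : (fun y => C y i j) = (fun y => 'D_(row i A) f y ord0 j)) //;
    apply/funext => y; rewrite mxE.
have E : \forall y \near x, w (f y) (C y) = epull w y A.
  by apply: filterS Ux => y Uy; rewrite /epull CE.
apply: (near_eq_is_derive E).
have D := is_derive_multilinear (dfU _ Uxx) mw dw dC.
apply: (@is_derive_eq _ _ _ _ _ _ _ _ D).
rewrite CE // deriveEjacobian //; last exact: dfU.
congr (_ + _); apply: eq_bigr => i _; congr (w _ (row_set _ _ _)).
have dD : derivable ('D_(row i A) f) x v by apply: diff_derivable; exact: (sf [:: row i A]).
apply/rowP => j; rewrite mxE -(derive_coord j dD).
by congr ('D_v _ x); apply/funext => y; rewrite mxE.
Qed.

Lemma ederivable_epull : ederivable (epull w) x.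
Proof. by move=> A v; have [] := is_derive_epull A v. Qed.

Hypothesis skw : skew_form (w (f x)).

Lemma ediff_epull (A : 'M[R]_(k.+1, m)) : ediff (epull w) x A = epull (ediff w) x A.
Proof.
(* The terms with second derivatives of [f] alternate a symmetric expression. *)
pose H u v : 'rV[R]_n := 'D_u ('D_v f) x.
pose T j (B : 'M[R]_(1 + k, m)) : R := w (f x)
  (row_set j (H (row ord0 B) (row j (row' ord0 B))) (row' ord0 B *m 'J f x)).
have T0 : alternation (fun B => \sum_j T j B) A = 0.
  rewrite alternation_sum big1 // => j _.
  apply: (@alternation_xrow_inv _ _ _ _ _ ord0 (lift ord0 j)) => [|//|B].
    by rewrite pnatr_eq0.
  have r0 : row ord0 (xrow ord0 (lift ord0 j) B) = row j (row' ord0 B).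
    by apply/rowP => q; rewrite !mxE tpermL.
  have rj : row j (row' ord0 (xrow ord0 (lift ord0 j) B)) = row ord0 B.
    by apply/rowP => q; rewrite !mxE tpermR.
  rewrite /T r0 rj /H (smooth_on_derive_comm _ _ sf Ux); congr (w _ _).
  apply/row_matrixP => i; rewrite !rowK; case: eqP => // /eqP ij.
  rewrite !row_mul; congr (_ *m _); apply/rowP => q; rewrite !mxE tpermD //.
  by rewrite eq_sym (inj_eq (lift_inj (h := ord0))).
have k0 : k`!%:R != 0 :> R by rewrite pnatr_eq0 -lt0n fact_gt0.
(* This is [T0] divided by k!: for a fixed first row, the sum over [j] is skew in the other rows. *)
have T1 : \sum_(i < k.+1) (-1) ^+ i *
    \sum_j T j (col_mx (row i A) (row' i A) : 'M[R]_(1 + k, m)) = 0.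
  apply: (mulfI k0); rewrite mulr0 -[RHS]T0 alternation_recl mulr_sumr.
  apply: eq_bigr => i _; rewrite mulrCA; congr (_ * _).
  rewrite (alternation_of_skew (F := fun B =>
    \sum_j T j (col_mx (row i A) B : 'M[R]_(1 + k, m)))) // => s B.
  rewrite mulr_sumr (reindex_inj (@perm_inj _ s^-1%g)); apply: eq_bigr => j _.
  rewrite /T !row0_col_mx !row'0_col_mx -skw; congr (w _ _).
  apply/row_matrixP => a; rewrite rowK.
  have -> : row a (row_perm s (row_set j (H (row i A) (row j B)) (B *m 'J f x))) =
            row (s a) (row_set j (H (row i A) (row j B)) (B *m 'J f x)).
    by apply/rowP => q; rewrite !mxE.
  rewrite rowK -(inj_eq (@perm_inj _ s)) permKV; case: eqP => _.
    by congr (H _ _); apply/rowP => q; rewrite !mxE permKV.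
  by rewrite !row_mul; congr (_ *m _); apply/rowP => q; rewrite !mxE.
rewrite -[RHS]addr0 -T1 /ediff /epull -big_split; apply: eq_bigr => i _ /=.
rewrite -mulrDr; congr (_ * _).
have [_ ->] := is_derive_epull (row' i A) (row i A).
rewrite row_mul row'_mul; congr (_ + _); apply: eq_bigr => j _.
by rewrite /T row0_col_mx row'0_col_mx.
Qed.

End Pullback.

(** * Forms on the total space of a submersion *)

Section NullForms.
Variables (R : realType) (n : nat).

(** The trace of multilinearity that contraction with a vertical vector uses: such a vector becomes
    a zero row under the Jacobian. It passes easily to wedges and to [ediff]. *)
Definition null_form k (w : 'M[R]_(k, n) -> R) : Prop :=
  forall i A, row i A = 0 -> w A = 0.

Lemma multilinear_null k (w : 'M[R]_(k, n) -> R) :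
  multilinear_form w -> null_form w.
Proof. by move=> mw i A; exact: multilinear_row0. Qed.

Lemma ewedge_null k l (a : eform R R n k) (b : eform R R n l) x :
  null_form (a x) -> null_form (b x) -> null_form (ewedge a b x).
Proof.
move=> na nb i A Ai; rewrite ewedgeE /alternation big1 ?mulr0 // => s _.
have As : row (s^-1%g i) (row_perm s A) = 0.
  by rewrite -Ai; apply/rowP => j; rewrite !mxE permKV.
move: As; case: (split_ordP (s^-1%g i)) => j -> As.
  rewrite (na j) ?mul0r ?mulr0 //.
  by rewrite -As; apply/rowP => q; rewrite !mxE.
rewrite (nb j) ?mulr0 //.
by rewrite -As; apply/rowP => q; rewrite !mxE.
Qed.

(** The zero row is either the direction of differentiation or an argument of [w]; in the latter
    case the differentiated function vanishes near [x]. *)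
Lemma ediff_null k (w : eform R R n k) x :
  (\forall y \near x, multilinear_form (w y)) -> null_form (ediff w x).
Proof.
move=> mw i A Ai; rewrite /ediff big1 // => j _.
case: (unliftP j i) => [l il|ij]; last by rewrite -ij Ai derive0 mulr0.
rewrite (_ : 'D_(row j A) _ x = 0) ?mulr0 //.
rewrite -[RHS](derive_cst (0 : R) x (row j A)); apply: near_eq_derive.
apply: filterS mw => y my; apply: (multilinear_row0 my (i := l)).
by rewrite row_row' -il.
Qed.
End NullForms.

Section HorizontalSplitting.
Variables (R : realType) (m n : nat) (f : 'rV[R]_m -> 'rV[R]_n).
Variables (x v : 'rV[R]_m) (eta : eform R R m 1).
Hypotheses (Jfull : row_full ('J f x)) (vJ : v *m 'J f x = 0).
Hypothesis eta_v : eta x v = 1.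

(** A full-rank Jacobian has a left inverse under right multiplication, so every argument matrix on
    the base lifts. *)
Lemma epull_inj k (w : eform R R n k) :
  (forall A, epull f w x A = 0) -> forall B, w (f x) B = 0.
Proof.
move=> w0 B; rewrite -[B](mulmxKpV (submx_full _ Jfull)).
exact: w0.
Qed.

Lemma horizontal_split k (a : eform R R n k.+1) (h : eform R R n k.+2) :
  skew_form (a (f x)) -> null_form (a (f x)) -> null_form (h (f x)) ->
  (forall A, epull f h x A +
     ewedge (epull f a) eta x (castmx (esym (addn1 k.+1), erefl m) A) = 0) ->
  (forall B, a (f x) B = 0) /\ (forall B, h (f x) B = 0).
Proof.
move=> ska na nh split0.
have ska' : skew_form (epull f a x).
  by move=> s A; rewrite /epull -row_perm_mul ska.
have a0 : forall B, a (f x) B = 0.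
  apply: epull_inj => A.
  have := split0 (col_mx v A : 'M[R]_(1 + k.+1, m)).
  rewrite ewedge_contract // => [|B B0]; last first.
    by rewrite /epull (na ord0) // row_mul B0.
  rewrite {1}/epull (nh ord0) ?add0r; last by rewrite row_mul row0_col_mx.
  by rewrite eta_v mulr1 => /eqP; rewrite mulf_eq0 signr_eq0 => /eqP.
split=> //; apply: epull_inj => A; have := split0 A.
rewrite (_ : ewedge _ _ _ _ = 0) ?addr0 //.
rewrite ewedgeE /alternation big1 ?mulr0 // => s _.
by rewrite /epull a0 mul0r mulr0.
Qed.
End HorizontalSplitting.

(** * Differentiating forms rescaled by powers of t *)

Section Conformal.
Variables (R : realType) (n : nat).

Lemma derive_ln_comp (T : 'rV[R]_n -> R) z v : differentiable T z -> 0 < T z ->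
  'D_v (fun y => ln (T y)) z = (T z)^-1 * 'D_v T z.
Proof.
move=> dT T0; have dl := is_derive1_ln T0.
have dln : differentiable (@ln R) (T z) by apply/derivable1_diffP; case: dl.
have [_ ->] := @is_derive_comp_diff _ _ _ _ _ (@ln R) _ v dT dln.
rewrite deriveE // -{1}['D_v T z]mulr1 -[_ * 1]/('D_v T z *: (1 : R)) linearZ /=.
by rewrite -deriveE // mulrC; case: dl => _ ->.
Qed.

Lemma is_derive_invX (T : 'rV[R]_n -> R) z v k : differentiable T z -> 0 < T z ->
  is_derive z v (fun y => T y ^- k) (- (k%:R * T z ^- k * 'D_v (fun y => ln (T y)) z)).
Proof.
move=> dT T0; rewrite derive_ln_comp //.
have Tn : T z != 0 by rewrite gt_eqF.
have d := derivableP (@diff_derivable _ _ _ _ _ v dT).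
have dX := is_deriveX k d.
have Tkn : (T ^+ k) z != 0 by rewrite exprfctE expf_neq0.
have [dTk DTk] := dX.
have E : (fun y => ((T ^+ k) y)^-1) = (fun y => T y ^- k).
  by apply/funext => y; rewrite exprfctE.
rewrite -E; apply: DeriveDef; first exact: derivableV.
rewrite deriveV // DTk exprfctE -[_ *: _]/(_ * _) -[_ *: 'D_v T z]/(_ * _).
case: k {dX Tkn dTk DTk E} => [|k]; first by rewrite !mul0r mulr0 oppr0.
rewrite /= expr2 [T z ^+ k.+1]exprS; field.
by rewrite Tn expf_neq0.
Qed.

(** Source of the d log t terms: used with k = 1 for omega3 and k = 2 for omega2. *)
Lemma ediff_conformal k l (T : 'rV[R]_n -> R) (w : eform R R n l) z A :
  differentiable T z -> 0 < T z -> skew_form (w z) -> ederivable w z ->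
  ediff (fun y B => T y ^- k * w y B) z A =
  T z ^- k * (ediff w z A -
    k%:R * ewedge (ediff (fun y (_ : 'M[R]_(0, n)) => ln (T y))) w z A).
Proof.
move=> dT T0 skw dw; rewrite ewedge1l // mulrBr [in RHS]/ediff !mulr_sumr -sumrB.
apply: eq_bigr => i _.
have [_ ->] := is_deriveM (is_derive_invX (row i A) k dT T0) (derivableP (dw (row' i A) (row i A))).
rewrite big_ord1 expr0 mul1r.
have -> : row ord0 (row i A) = row i A by apply/rowP => j; rewrite mxE.
rewrite -[_ *: _]/(_ * _) -[_ *: (- _)]/(_ * _).
ring.
Qed.
End Conformal.

Lemma ewedge_eq0l (R : realType) (K : numFieldType) n k l (a : eform R K n k)
    (b : eform R K n l) x A : (forall B, a x B = 0) -> ewedge a b x A = 0.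
Proof.
move=> a0; rewrite ewedgeE /alternation big1 ?mulr0 // => s _.
by rewrite a0 mul0r mulr0.
Qed.

Lemma ewedge_eq0r (R : realType) (K : numFieldType) n k l (a : eform R K n k)
    (b : eform R K n l) x A : (forall B, b x B = 0) -> ewedge a b x A = 0.
Proof.
move=> b0; rewrite ewedgeE /alternation big1 ?mulr0 // => s _.
by rewrite b0 !mulr0.
Qed.

(** Shaped after [ediff_conformal], to pull t^-k out of a wedge; p = -1 and q = 0 give negation. *)
Lemma ewedge_linl (R : realType) (K : numFieldType) n k l (a u w : eform R K n k)
    (b : eform R K n l) (p q : K) x A :
  (forall B, a x B = p * (u x B - q * w x B)) ->
  ewedge a b x A = p * (ewedge u b x A - q * ewedge w b x A).
Proof.
move=> aE; rewrite !ewedgeE [q * _]mulrCA -mulrBr mulrCA; congr (_ * _).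
rewrite -alternationZ -mulrN1 -[_ * -1]mulrC -alternationZ -alternationD -alternationZ.
by apply: eq_alternation => B; rewrite aE; ring.
Qed.

Section FormNear.
Variables (R : realType) (n : nat).

(** The germ of a smooth form at [x], reduced to what [d] and pullback use there. It is stable under
    multiplication by a function differentiable at [x], hence by t^-k. *)
Definition form_near k (w : eform R R n k) x : Prop :=
  (\forall y \near x, multilinear_form (w y) /\ skew_form (w y)) /\
  forall B, differentiable (fun y => w y B) x.

Lemma is_eform_near k (w : eform R R n k) (V : set 'rV[R]_n) x :
  is_eform V w -> nbhs x V -> form_near w x.
Proof.
move=> [mw sw] Vx; split; last by move=> B; exact: (sw B [::] _ (nbhs_singleton Vx)).
apply: filterS Vx => y /mw [my ay]; split=> //; exact: skew_of_alternating.
Qed.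

Lemma form_near_ederivable k (w : eform R R n k) x : form_near w x -> ederivable w x.
Proof. by move=> [_ dw] B v; exact: diff_derivable. Qed.

Lemma form_near_multilinear k (w : eform R R n k) x :
  form_near w x -> \forall y \near x, multilinear_form (w y).
Proof. by move=> [mw _]; apply: filterS mw => y []. Qed.

Lemma form_near_skew k (w : eform R R n k) x :
  form_near w x -> \forall y \near x, skew_form (w y).
Proof. by move=> [mw _]; apply: filterS mw => y []. Qed.

Lemma form_near_scale k (w : eform R R n k) (h : 'rV[R]_n -> R) x :
  differentiable h x -> form_near w x -> form_near (fun y B => h y * w y B) x.
Proof.
move=> dh [mw dw]; split; last by move=> B; exact: differentiableM.
apply: filterS mw => y [my sky]; split=> [A B C i b c Ai BA CA|s A].
  by rewrite (my _ _ _ _ _ _ Ai BA CA); ring.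
by rewrite sky mulrCA.
Qed.
End FormNear.

(** * The closedness conditions in a pair of charts *)

Section ChartReduction.
Variables (R : realType) (m n : nat) (f : 'rV[R]_m -> 'rV[R]_n).
Variables (U : set 'rV[R]_m) (x v : 'rV[R]_m) (T : 'rV[R]_n -> R).
Variables (eta : eform R R m 1) (a : eform R R n 1) (ph : eform R R n 2).
Hypotheses (sf : smooth_on U f) (Ux : nbhs x U).
Hypotheses (Jfull : row_full ('J f x)) (vJ : v *m 'J f x = 0).
Hypotheses (dT : differentiable T (f x)) (T0 : 0 < T (f x)).
Hypotheses (deta : ederivable eta x) (eta_v : eta x v = 1).
Hypothesis d_eta : forall A, ediff eta x A = epull f ph x A.
Hypotheses (fa : form_near a (f x)) (fph : form_near ph (f x)).

Local Notation dlog := (ediff (fun y (_ : 'M[R]_(0, n)) => ln (T y))).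

Let pull_ederivable k (w : eform R R n k) :
  form_near w (f x) -> ederivable (epull f w) x.
Proof.
move=> fw; apply: (ederivable_epull sf Ux (form_near_multilinear fw)).
by case: fw.
Qed.

Let pull_ediff k (w : eform R R n k) :
  form_near w (f x) -> ediff (epull f w) x =1 epull f (ediff w) x.
Proof.
move=> fw A; apply: (ediff_epull sf Ux (form_near_multilinear fw)).
  by case: fw.
exact: nbhs_singleton (form_near_skew fw).
Qed.

Let null k (w : eform R R n k) : form_near w (f x) -> null_form (w (f x)).
Proof.
by move=> /form_near_multilinear /nbhs_singleton; exact: multilinear_null.
Qed.

Let dnull k (w : eform R R n k) : form_near w (f x) -> null_form (ediff w (f x)).
Proof. by move=> /form_near_multilinear; exact: ediff_null. Qed.

Let dskew k (w : eform R R n k) : form_near w (f x) -> skew_form (ediff w (f x)).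
Proof.
by move=> fw; exact: ediff_skew (form_near_skew fw) (form_near_ederivable fw).
Qed.

Let form_near_conformal k j (w : eform R R n k) :
  form_near w (f x) -> form_near (fun y B => T y ^- j * w y B) (f x).
Proof.
apply: form_near_scale; apply: differentiableV; last by rewrite expf_neq0 // gt_eqF.
case: j => [|j]; first exact: (differentiable_cst (1 : R)).
by have := differentiableX j dT; rewrite exprfctE.
Qed.

(** Since d(a /\ eta) = da /\ eta - a /\ ph, d om is the pullback of [h] plus that of [a'] wedged
    with eta, and [horizontal_split] separates them. [hE] shows that h = 0 is the equation for d o3
    divided by t. *)
Lemma closed_2form_reduction (om : eform R R m 2) (o3 : eform R R n 2) :
  form_near o3 (f x) ->
  (forall A, \forall y \near x, om y A =
     epull f (fun z B => T z ^- 1 * o3 z B) y A - ewedge (epull f a) eta y A) ->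
  (forall A, ediff om x A = 0) <->
  (forall B, ediff a (f x) B = 0) /\
  (forall B, ediff o3 (f x) B = ewedge dlog o3 (f x) B - T (f x) * ewedge a ph (f x) B).
Proof.
move=> fo omE; set b := fun z B => _ in omE.
have fb : form_near b (f x) by exact: form_near_conformal.
pose h : eform R R n 3 := fun z B => ediff b z B + ewedge a ph z B.
pose a' : eform R R n 2 := fun z B => - ediff a z B.
have hE B : h (f x) B = (T (f x))^-1 *
    (ediff o3 (f x) B - ewedge dlog o3 (f x) B + T (f x) * ewedge a ph (f x) B).
  rewrite /h ediff_conformal //; last exact: form_near_ederivable.
    by rewrite mul1r expr1 [RHS]mulrDr mulKf // gt_eqF.
  exact: nbhs_singleton (form_near_skew fo).
have dom A : ediff om x A = epull f h x A + ewedge (epull f a') eta x A.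
  rewrite (@near_eq_ediff _ _ _ om (fun y B => epull f b y B + - ewedge (epull f a) eta y B)) //.
  have d1 : ederivable (ewedge (epull f a) eta) x.
    by apply: (@ederivable_ewedge _ _ 1 1); [exact: pull_ederivable | exact: deta].
  rewrite (ediffD A (pull_ederivable fb) (ederivableN d1)) (ediffN A d1).
  rewrite (@ediff_ewedge _ _ 1 1); [|exact: pull_ederivable|exact: deta].
  rewrite castmx_id pull_ediff //.
  have -> : ewedge (epull f a') eta x A = - ewedge (ediff (epull f a)) eta x A.
    rewrite (@ewedge_linl _ _ _ _ _ _ (ediff (epull f a)) (ediff (epull f a)) _ (-1) 0).
      by rewrite mul0r subr0 mulN1r.
    by move=> B; rewrite pull_ediff // mul0r subr0 mulN1r.
  have -> : ewedge (epull f a) (ediff eta) x A = epull f (ewedge a ph) x A.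
    by rewrite epull_ewedge; exact: eq_ewedge.
  rewrite /epull /h; ring.
have cast1 (A : 'M[R]_(3, m)) : castmx (esym (addn1 2), erefl m) A = A by rewrite castmx_id.
split=> [om0|[da do3] A].
  have [] := @horizontal_split _ _ _ f x v eta Jfull vJ eta_v 1 a' h.
  - by move=> s A; rewrite /a' dskew // mulrN.
  - by move=> i A Ai; rewrite /a' (dnull fa Ai) oppr0.
  - move=> i A Ai; rewrite /h (dnull fb Ai) add0r.
    exact: (ewedge_null (null fa) (null fph) Ai).
  - by move=> A; rewrite cast1 -dom.
  move=> a0 h0; split=> B; first by apply/eqP; rewrite -oppr_eq0; apply/eqP; exact: a0.
  have := h0 B; rewrite hE => /eqP; rewrite mulf_eq0 invr_eq0 gt_eqF //= => /eqP H.
  by apply/eqP; rewrite -subr_eq0 -H; apply/eqP; ring.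
rewrite dom ewedge_eq0l ?addr0 => [|B]; last by rewrite /epull /a' da oppr0.
by rewrite /epull hE do3 [X in _ * X](_ : _ = 0) ?mulr0 //; ring.
Qed.

(** Here da = 0 removes the term t^-2 o2 /\ da, which leaves o1 /\ ph - d(t^-2 o2) /\ a as
    horizontal part; multiplied by t^2 it is the equation for d o2 /\ a. *)
Lemma closed_3form_reduction (ps : eform R R m 3) (o1 o2 : eform R R n 2) :
  form_near o1 (f x) -> form_near o2 (f x) -> (forall B, ediff a (f x) B = 0) ->
  (forall A, \forall y \near x, ps y A = ewedge (epull f o1) eta y A -
     ewedge (epull f (fun z B => T z ^- 2 * o2 z B)) (epull f a) y A) ->
  (forall A, ediff ps x A = 0) <->
  (forall B, ediff o1 (f x) B = 0) /\
  (forall B, ewedge (ediff o2) a (f x) B =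
     T (f x) ^+ 2 * ewedge o1 ph (f x) B + 2 * ewedge (ewedge dlog o2) a (f x) B).
Proof.
move=> fo1 fo2 da psE; set b := fun z B => _ in psE.
have fb : form_near b (f x) by exact: form_near_conformal.
pose h : eform R R n 4 := fun z B => ewedge o1 ph z B - ewedge (ediff b) a z B.
have hE B : h (f x) B = T (f x) ^- 2 * (T (f x) ^+ 2 * ewedge o1 ph (f x) B -
    (ewedge (ediff o2) a (f x) B - 2 * ewedge (ewedge dlog o2) a (f x) B)).
  rewrite /h (@ewedge_linl _ _ _ _ _ (ediff b) (ediff o2) (ewedge dlog o2) _ (T (f x) ^- 2) 2).
    by rewrite [RHS]mulrBr mulKf // expf_neq0 // gt_eqF.
  move=> C; rewrite /b (ediff_conformal 2) //; first exact: nbhs_singleton (form_near_skew fo2).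
  exact: form_near_ederivable.
have dps A : ediff ps x A = epull f h x A + ewedge (epull f (ediff o1)) eta x A.
  rewrite (@near_eq_ediff _ _ _ ps (fun y B => ewedge (epull f o1) eta y B
    + - ewedge (epull f b) (epull f a) y B)) //.
  have d1 : ederivable (ewedge (epull f o1) eta) x.
    by apply: (@ederivable_ewedge _ _ 2 1); [exact: pull_ederivable | exact: deta].
  have d2 : ederivable (ewedge (epull f b) (epull f a)) x.
    by apply: (@ederivable_ewedge _ _ 2 1); exact: pull_ederivable.
  rewrite (ediffD A d1 (ederivableN d2)) (ediffN A d2).
  rewrite (@ediff_ewedge _ _ 2 1); [|exact: pull_ederivable|exact: deta].
  rewrite (@ediff_ewedge _ _ 2 1); try exact: pull_ederivable.
  rewrite !castmx_id sqrrN expr1n !mul1r.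
  have -> : ewedge (ediff (epull f o1)) eta x A = ewedge (epull f (ediff o1)) eta x A.
    by apply: eq_ewedge => // B; exact: pull_ediff.
  have -> : ewedge (epull f o1) (ediff eta) x A = epull f (ewedge o1 ph) x A.
    by rewrite epull_ewedge; exact: eq_ewedge.
  have -> : ewedge (ediff (epull f b)) (epull f a) x A = epull f (ewedge (ediff b) a) x A.
    by rewrite epull_ewedge; apply: eq_ewedge => // B; exact: pull_ediff.
  rewrite (@ewedge_eq0r _ _ _ 2 2 _ (ediff (epull f a))) => [|B]; last first.
    by rewrite pull_ediff // /epull da.
  rewrite /epull /h; ring.
have cast1 (A : 'M[R]_(4, m)) : castmx (esym (addn1 3), erefl m) A = A by rewrite castmx_id.
split=> [ps0|[do1 do2] A].
  have [] := @horizontal_split _ _ _ f x v eta Jfull vJ eta_v 2 (ediff o1) h.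
  - exact: dskew.
  - exact: dnull.
  - move=> i A Ai; rewrite /h (ewedge_null (null fo1) (null fph) Ai) sub0r.
    by rewrite (@ewedge_null _ _ 3 1 _ _ _ (dnull fb) (null fa) i A Ai) oppr0.
  - by move=> A; rewrite cast1 -dps.
  move=> a0 h0; split=> // B.
  have := h0 B; rewrite hE => /eqP; rewrite mulf_eq0 invr_eq0 expf_eq0 gt_eqF //= => /eqP H.
  by apply/eqP; rewrite -subr_eq0 -[X in _ == X]oppr0 -[in X in _ == X]H; apply/eqP; ring.
rewrite dps ewedge_eq0l ?addr0 => [|B]; last by rewrite /epull do1.
by rewrite /epull hE do2 [X in _ * X](_ : _ = 0) ?mulr0 //; ring.
Qed.

End ChartReduction.

(** * The quotient by the vector field *)

(** Contraction is an antiderivation; the sign is + because [om] has even degree. *)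
Lemma ewedge21_contract (R : realType) n (om : eform R R n 2) (et : eform R R n 1)
    y v (A : 'M[R]_(2, n)) : skew_form (om y) ->
  ewedge om et y (col_mx v A : 'M[R]_(1 + 2, n)) =
  om y A * et y v +
  ewedge (fun z B => om z (col_mx v B : 'M[R]_(1 + 1, n))) et y A.
Proof.
move=> sko; rewrite ewedge21 // big_ord_recl row0_col_mx row'0_col_mx mul1r.
congr (_ + _).
have := @ewedge1r R R n 1 (fun z B => om z (col_mx v B : 'M[R]_(1 + 1, n)))
  et y A (@skew_form1 _ _ _ _).
rewrite castmx_id => ->; apply: eq_bigr => i _.
by rewrite row_lift0_col_mx row'_lift0_col_mx.
Qed.

Lemma skew_form_col_mx (R : Type) (K : fieldType) n k (w : 'M[R]_(1 + k, n) -> K) v :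
  skew_form w -> skew_form (fun B : 'M[R]_(k, n) => w (col_mx v B)).
Proof.
move=> skw s B; have := skw (lift_perm ord0 ord0 s) (col_mx v B).
rewrite row_perm_lift_perm row0_col_mx row'0_col_mx => ->.
by rewrite odd_lift_perm.
Qed.

Section Charts.
Variables (R : realType) (m n : nat) (M : manifold R m) (N : manifold R n).
Variables (h : M -> N) (c : atlas M) (c' : atlas N) (p : M).
Hypotheses (pc : chart_dom c p) (pc' : chart_dom c' (h p)).

Lemma nbhs_chart_cod : nbhs (chart c p) (chart_cod c).
Proof. by apply: open_nbhs_nbhs; split; [exact: chart_cod_open | exists p]. Qed.

Lemma local_mapE : local_map h c c' (chart c p) = chart c' (h p).
Proof. by rewrite /local_map /= chartK. Qed.

Lemma nbhs_chart_overlap : continuous h ->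
  nbhs (chart c p) (chart c @` (chart_dom c `&` h @^-1` chart_dom c')).
Proof.
move=> ch.
have nD : nbhs p (chart_dom c `&` h @^-1` chart_dom c').
  apply: filterI; first by apply: open_nbhs_nbhs; split=> //; exact: chart_dom_open.
  by apply: (ch p); apply: open_nbhs_nbhs; split=> //; exact: chart_dom_open.
have ci := chart_inv_continuous pc.
have nI : nbhs (chart c p) (chart_inv c @^-1` (chart_dom c `&` h @^-1` chart_dom c')).
  by apply: ci; rewrite chartK.
apply: filterS2 nbhs_chart_cod nI => y [q qc <-] /=; rewrite chartK // => qD.
by exists q.
Qed.

Lemma pullback_local k (w : mform N R k) (w' : mform M R k) :
  is_pullback h w w' -> forall y,
  (chart c @` (chart_dom c `&` h @^-1` chart_dom c')) y ->
  forall A, w' c y A = epull (local_map h c c') (w c') y A.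
Proof.
move=> pw y [q [qc qc'] <-] A.
by rewrite (pw c c' q qc qc') /epull /local_map /= chartK.
Qed.
End Charts.

Section VerticalField.
Variables (R : realType) (M : manifold R 6) (N : manifold R 5).

Lemma regular_vector_field_vertical (X : mfield M) (h : M -> N) c c' p :
  regular_vector_field X h -> chart_dom c p -> chart_dom c' (h p) ->
  X c (chart c p) *m 'J (local_map h c c') (chart c p) = 0.
Proof.
move=> [_ _ [[ch sh] _] _ orb] pc pc'.
have [I [gam [oI iI ig [a [b [Ia _ ga _]]]]]] := (orb p p).1 erefl.
have [cga dga] := ig a Ia.
have pca : chart_dom c (gam a) by rewrite ga.
have dcg := dga c pca; rewrite ga in dcg.
set f := local_map h c c'.
have df : differentiable f (chart c p).
  by apply: (sh c c' [::]); exists p.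
have dfg : differentiable f ((chart c \o gam) a) by rewrite /= ga.
have dg : differentiable (chart c \o gam) a.
  by apply/derivable1_diffP; case: dcg.
have [_] := @is_derive_comp_diff _ _ _ _ _ _ _ (1 : R) dg dfg.
have -> : 'D_1 (chart c \o gam) a = X c (chart c p) by case: dcg.
rewrite /= ga deriveEjacobian // => <-.
rewrite -[RHS](derive_cst (f (chart c p)) a 1); apply: near_eq_derive.
have nI : nbhs a I by exact: open_nbhs_nbhs.
have nC : \forall s \near a, chart_dom c (gam s).
  by apply: cga; rewrite ga; apply: open_nbhs_nbhs; split=> //; exact: chart_dom_open.
apply: filterS2 nI nC => s Is cs.
rewrite /f /local_map /= !chartK //; congr (chart c' _).
by apply/orb; exists I, gam; split=> //; exists s, a.
Qed.
End VerticalField.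

Section QuotientReduction.
Variables (R : realType) (M : manifold R 6) (N : manifold R 5).
Variables (omega : mform M R 2) (Psi : mform M R[i] 3) (X : mfield M) (h : M -> N).
Variables (g : mtensor2 M) (eta : mform M R 1).
Variables (alpha : mform N R 1) (omega1 omega2 omega3 phi : mform N R 2) (t : N -> R).
Hypotheses (hsu3 : su3_structure omega Psi) (hX : regular_vector_field X h).
Hypothesis hq :
  quotient_data omega Psi X h g eta alpha omega1 omega2 omega3 phi t.

Let h_submersion : submersion h. Proof. by case: hX. Qed.

(** With eta = l g(X, .), the normalisation eta(X) = 1 reads l g(X, X) = 1. This shows g(X, X) to be
    nonzero and identifies l as t^-2. *)
Lemma quotient_norm c p : chart_dom c p ->
  let x := chart c p in
  [/\ 0 < t (h p), t (h p) ^+ 2 = g c x (X c x) (X c x)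
    & forall v, eta c x v = t (h p) ^- 2 * g c x (X c x) v].
Proof.
move=> pc x.
have cx : chart_cod c x by exists p.
have [l etaE] := qd_eta_dual hq cx.
have g_ge0 : 0 <= g c x (X c x) (X c x).
  have [V [e [_ Vx _ _ gE]]] := qd_metric hq cx.
  by rewrite gE // sumr_ge0 // => i _; rewrite -expr2 sqr_ge0.
have lg : l * g c x (X c x) (X c x) = 1 by rewrite -etaE (qd_eta_X hq).
have g0 : g c x (X c x) (X c x) != 0.
  by apply: contra_eq_neq lg => ->; rewrite mulr0 eq_sym oner_neq0.
have t2 : t (h p) ^+ 2 = g c x (X c x) (X c x) by rewrite (qd_norm hq pc) sqr_sqrtr.
split=> // [|v]; first by rewrite (qd_norm hq pc) sqrtr_gt0 lt_def g0.
by rewrite t2 etaE -[l](mulfK g0) lg mul1r.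
Qed.

Variables (c : atlas M) (c' : atlas N).

Local Notation f := (local_map h c c').
Local Notation U := (chart c @` (chart_dom c `&` h @^-1` chart_dom c')).
Local Notation T := (fun z => t (chart_inv c' z)).

Lemma omega_skew y : chart_cod c y -> skew_form (omega c y).
Proof.
case: hsu3 => -[om _ _ _ _] cy; have [/(_ y cy) [mo ao] _] := om c.
exact: skew_of_alternating.
Qed.

Lemma im_Psi_skew y : chart_cod c y -> skew_form (im_form Psi c y).
Proof.
case: hsu3 => _ _ [om _ _] cy; have [/(_ y cy) [mo ao] _] := om c.
exact: skew_of_alternating.
Qed.

Lemma re_Psi_skew y : chart_cod c y -> skew_form (re_form Psi c y).
Proof.
case: hsu3 => _ [om _ _ _] cy; have [/(_ y cy) [mo ao] _] := om c.
exact: skew_of_alternating.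
Qed.

(** No coframe enters: X _| (omega /\ eta) = omega + (X _| omega) /\ eta, so the definition of
    omega3 can be solved for omega. *)
Lemma omega_decomposition y A : U y ->
  omega c y A = epull f (fun z B => T z ^- 1 * omega3 c' z B) y A -
    ewedge (epull f (alpha c')) (eta c) y A.
Proof.
move=> Uy; have [q [qc qc'] yq] := Uy.
have cy : chart_cod c y by exists q.
have [t0 _ _] := quotient_norm qc.
have Tf : T (f y) = t (h q) by rewrite -yq local_mapE // chartK.
have o3 := pullback_local (qd_omega3 hq).2 Uy A.
have aE B := pullback_local (qd_alpha hq).2 Uy B.
have -> : epull f (fun z B => T z ^- 1 * omega3 c' z B) y A =
    (t (h q))^-1 * epull f (omega3 c') y A by rewrite /epull Tf expr1.
rewrite -o3 /form_scale /= -yq chartK // yq mulKf ?gt_eqF //.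
rewrite /int_product /form_wedge ewedge21_contract; last exact: omega_skew.
rewrite (qd_eta_X hq) // mulr1.
rewrite (@eq_ewedge _ _ _ 1 1 (epull f (alpha c'))
  (fun z B => omega c z (col_mx (X c y) B : 'M[R]_(1 + 1, 6))) _ (eta c) y y) ?addrK // => B.
by rewrite -aE.
Qed.

Lemma re_Psi_decomposition y A : U y ->
  re_form Psi c y A = ewedge (epull f (omega1 c')) (eta c) y A -
    ewedge (epull f (fun z B => T z ^- 2 * omega2 c' z B)) (epull f (alpha c')) y A.
Proof.
move=> Uy; have [q [qc qc'] yq] := Uy.
have cy : chart_cod c y by exists q.
have [t0 t2 etaE] := quotient_norm qc; rewrite yq in t2 etaE.
have Tf : T (f y) = t (h q) by rewrite -yq local_mapE // chartK.
have o1 B := pullback_local (qd_omega1 hq).2 Uy B.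
have o2 B := pullback_local (qd_omega2 hq).2 Uy B.
have aE B := pullback_local (qd_alpha hq).2 Uy B.
have tn : t (h q) ^+ 2 != 0 by rewrite expf_neq0 // gt_eqF.
(* The coframe is taken from [qd_metric]: it is adapted to the structure and at the same time
   diagonalises [g]. *)
have [V [e [_ Vy _ ac gE]]] := qd_metric hq cy.
(* Multiplied by t^2 = |X|^2, the claim is [adapted_coframe_reduction]. The factor t^2 is absorbed
   by X^flat = t^2 eta in the first wedge and cancels t^-2 in the second. *)
apply: (mulfI tn); rewrite {1}t2 gE //.
rewrite /re_form (adapted_coframe_reduction (X c y) A ac Vy).
have sk1 : skew_form (epull f (omega1 c') y).
  move=> s B; rewrite -!o1 /int_product.
  exact: (skew_form_col_mx (X c y) (re_Psi_skew cy)).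
have sk2 : skew_form (epull f (fun z B => T z ^- 2 * omega2 c' z B) y).
  move=> s B; rewrite /epull -row_perm_mul mulrCA; congr (_ * _).
  rewrite row_perm_mul -[LHS]o2 -[omega2 _ _ _]o2 /int_product.
  exact: (skew_form_col_mx (X c y) (im_Psi_skew cy)).
rewrite !ewedge21 // mulrBr !mulr_sumr -sumrB; apply: eq_bigr => j _.
rewrite etaE -!gE // -o1 -aE /epull Tf -[omega2 _ _ _]o2 /int_product /re_form /im_form.
field.
by rewrite gt_eqF.
Qed.

Hypotheses (p : M) (pc : chart_dom c p) (pc' : chart_dom c' (h p)).

Lemma half_flat_at :
  let x := chart c p in let z := chart c' (h p) in
  let dlog := ediff (fun y (_ : 'M[R]_(0, 5)) => ln (T y)) in
  (forall A, ediff (omega c) x A = 0) /\ (forall A, ediff (re_form Psi c) x A = 0) <->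
  [/\ forall B, ediff (alpha c') z B = 0,
      forall B, ediff (omega1 c') z B = 0,
      forall B, ewedge (ediff (omega2 c')) (alpha c') z B =
        T z ^+ 2 * ewedge (omega1 c') (phi c') z B +
        2 * ewedge (ewedge dlog (omega2 c')) (alpha c') z B
    & forall B, ediff (omega3 c') z B =
        ewedge dlog (omega3 c') z B - T z * ewedge (alpha c') (phi c') z B].
Proof.
move=> x z dlog.
have [[ch sh] row_full_J] := h_submersion.
have fx : f x = z := local_mapE h c' pc.
have sf : smooth_on U f := sh c c'.
have Ux : nbhs x U := nbhs_chart_overlap pc pc' ch.
have nz : nbhs z (chart_cod c') := nbhs_chart_cod pc'.
have nx : nbhs x (chart_cod c) := nbhs_chart_cod pc.
have near_form k (w : mform N R k) : is_mform w -> form_near (w c') (f x).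
  by move=> [/(_ c') ew _]; rewrite fx; exact: is_eform_near ew nz.
have fa := near_form _ _ (qd_alpha hq).1.
have f1 := near_form _ _ (qd_omega1 hq).1.
have f2 := near_form _ _ (qd_omega2 hq).1.
have f3 := near_form _ _ (qd_omega3 hq).1.
have fp := near_form _ _ (qd_phi hq).1.
have dT : differentiable T (f x).
  (* [t] is given as a 0-form; its differentiability is read off at the empty matrix. *)
  have [_ /(_ 0)] := near_form _ _ (qd_t hq); exact.
have [t0 _ _] := quotient_norm pc.
have T0 : 0 < T (f x) by rewrite fx chartK.
have deta : ederivable (eta c) x.
  by have [/(_ c) ew _] := qd_eta hq; exact: form_near_ederivable (is_eform_near ew nx).
have eta_v : eta c x (X c x) = 1 by apply: (qd_eta_X hq); exists p.
have vJ : X c x *m 'J f x = 0 := regular_vector_field_vertical hX pc pc'.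
have d_eta A : ediff (eta c) x A = epull f (phi c') x A.
  by rewrite -(pullback_local (qd_phi hq).2) //; exists p.
have near3 A : \forall y \near x, omega c y A =
    epull f (fun z B => T z ^- 1 * omega3 c' z B) y A -
    ewedge (epull f (alpha c')) (eta c) y A.
  by apply: filterS Ux => y; exact: omega_decomposition.
have near1 A : \forall y \near x, re_form Psi c y A =
    ewedge (epull f (omega1 c')) (eta c) y A -
    ewedge (epull f (fun z B => T z ^- 2 * omega2 c' z B)) (epull f (alpha c')) y A.
  by apply: filterS Ux => y; exact: re_Psi_decomposition.
have Jfull := row_full_J c c' p pc pc'.
have E3 := closed_2form_reduction sf Ux Jfull vJ dT T0 deta eta_v d_eta fa fp f3 near3.
(* [E1] is a function of d alpha = 0, which [E3] provides in one direction and the assumptions in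
   the other. *)
have E1 := fun da => closed_3form_reduction sf Ux Jfull vJ dT T0 deta eta_v d_eta fa fp
  f1 f2 da near1.
rewrite fx in E3 E1.
split=> [[/E3 [da do3] dps]|[da do1 do2 do3]].
  by have [do1 do2] := (E1 da).1 dps; split.
by split; [apply/E3; split | apply/(E1 da); split].
Qed.
End QuotientReduction.

Theorem proposition5p2 (R : realType) (M : manifold R 6) (N : manifold R 5)
    (omega : mform M R 2) (Psi : mform M R[i] 3)
    (X : mfield M) (pi : M -> N) (g : mtensor2 M) (eta : mform M R 1)
    (alpha : mform N R 1) (omega1 omega2 omega3 phi : mform N R 2)
    (t : N -> R)
    (hsu3 : su3_structure omega Psi)
    (hX : regular_vector_field X pi)
    (hpres : preserves X omega Psi)
    (hq : quotient_data omega Psi X pi g eta alpha omega1 omega2 omega3 phi t) :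
  let dlogt := form_diff (form_of_fun (fun y => ln (t y))) in
  symplectic_half_flat omega Psi <->
  [/\ (form_diff alpha == 0)%F,
      (form_diff omega1 == 0)%F,
      (form_diff omega2 /\~ alpha ==
         (fun y => t y ^+ 2)%R *: (omega1 /\~ phi)
         + (fun=> 2%R) *: (dlogt /\~ omega2 /\~ alpha))%F
    & (form_diff omega3 == dlogt /\~ omega3 - t *: (alpha /\~ phi))%F].
Proof.
move=> dlogt; have at_p := half_flat_at hsu3 hX hq.
have [_ _ _ onto _] := hX.
split=> [[dom dps]|[da do1 do2 do3]].
  (* A point in a chart of N has the form [chart c' q]; any preimage [p] of [q] and any chart around
     [p] will do, and the form equations unfold to those of [half_flat_at]. *)
  split=> c' _ [q qc' <-] B; have [p pq] := onto q; rewrite -pq in qc' *;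
    have [c pc] := chart_dom_cover p;
    have cx : chart_cod c (chart c p) by [exists p];
    have [e1 e2 e3 e4] := (at_p c c' p pc qc').1 (conj (dom c _ cx) (dps c _ cx)).
  - exact: e1.
  - exact: e2.
  - exact: e3.
  - exact: e4.
have eqs c p : chart_dom c p ->
    (forall A, ediff (omega c) (chart c p) A = 0) /\
    (forall A, ediff (re_form Psi c) (chart c p) A = 0).
  move=> pc; have [c' pc'] := chart_dom_cover (pi p).
  have cz : chart_cod c' (chart c' (pi p)) by exists (pi p).
  apply/(at_p c c' p pc pc'); split.
  - exact: da cz.
  - exact: do1 cz.
  - exact: do2 cz.
  - exact: do3 cz.
by split=> c _ [p pc <-] A; [apply: (eqs c p pc).1 | apply: (eqs c p pc).2].
Qed.
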